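(* Let $N$ be a positive integer, $p$ a prime with $(p,N)=1$, and $r$ a positive integer. Then for every $f\in\mathcal{M}(N)$, $$\mathfrak{D}(f|\mathcal{T}(p^{r}))=\mathfrak{D}(f)|T_2(p^{r}).$$
   Context: Let $q=e^{2\pi i\tau}$. $\mathcal{M}(N)$ denotes the multiplicative group of meromorphic modular forms $f$ on the upper half-plane of some integer weight $k$ for $\Gamma_0(N)$ with some unitary multiplier system (i.e. $f(\gamma\tau)=\chi(\gamma)(c\tau+d)^kf(\tau)$ for $\gamma\in\Gamma_0(N)$, $\chi:\Gamma_0(N)\to S^1$, meromorphic at cusps), with integer Fourier coefficients at $i\infty$ and leading coefficient $1$. With $(f|_k\gamma)(\tau)=\det(\gamma)^{k/2}(c\tau+d)^{-k}f(\gamma\tau)$, for a prime $p\nmid N$, $r\ge1$: $f|\mathcal{T}(p^{r}):=\varepsilon\, p^{\frac{k}{1-p}\left(\frac{p^{r+1}-p}{p-1}-\frac{r}{2}(p^{r+1}+1)\right)}\prod_{ad=p^{r},\,0\le b<d}f|_{k}\begin{psmallmatrix}a&b\\0&d\end{psmallmatrix}$ ($a,d>0$), $\varepsilon$ the constant making the leading coefficient 1; it lies in $\mathcal{M}(N)$ with weight $k\sigma(p^r)$, $\sigma$ the divisor sum. $M_2^{\mathrm{mero}}(N)$ is the space of meromorphic modular forms of weight 2 on $\Gamma_0(N)$. $\Theta=q\frac{d}{dq}$, $E_2(\tau)=1-24\sum_{n\ge1}\sigma(n)q^n$, and for $f\in\mathcal{M}(N)$ of weight $k$, $\mathfrak{D}(f):=\Theta(f)/f-kE_2/12\in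 M_2^{\mathrm{mero}}(N)$. For $(n,N)=1$ and $g\in M_2^{\mathrm{mero}}(N)$, $(g|T_2(n))(\tau):=\sum_{ad=n,\,0\le b<d}g|_2\begin{psmallmatrix}a&b\\0&d\end{psmallmatrix}(\tau)=\sum_{ad=n,\,0\le b<d}\frac{n}{d^2}g\big(\frac{a\tau+b}{d}\big)$. *)

(* Defs.v *)
From HB Require Import structures.
From mathcomp Require Import all_boot all_order all_algebra.
From mathcomp Require Import complex.
From mathcomp Require Import all_classical all_reals all_analysis.

Set Implicit Arguments.
Unset Strict Implicit.
Unset Printing Implicit Defensive.

Import Order.TTheory GRing.Theory Num.Theory.
Import numFieldNormedType.Exports.
Local Open Scope classical_set_scope.
Local Open Scope ring_scope.

(* R[i] packed as a numClosedFieldType: this is what gives it its norm topology,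
   so that [f^`()] and [derivable f z 1] for f : Cplx R -> Cplx R are the
   complex derivative and complex differentiability. *)
Definition Cplx (R : realType) : numClosedFieldType := R[i]%C.

(* sigma(n); note that divisors 0 = [::] *)
Definition sigma (n : nat) : nat := (\sum_(d <- divisors n) d)%N.

Definition mx2 (a b c d : int) : 'M[int]_2 :=
  \matrix_(i, j) if i == 0 then (if j == 0 then a else b)
                 else (if j == 0 then c else d).

Definition SL2Z (g : 'M[int]_2) : Prop := \det g = 1.

Definition Gamma0 (N : nat) (g : 'M[int]_2) : Prop :=
  SL2Z g /\ (N%:Z %| g 1%R 0%R)%Z.

Section ModularForms.
Context {R : realType}.
Local Notation C := (Cplx R).
Implicit Types (f g : C -> C) (t : C) (k : int) (gam : 'M[int]_2).

Definition RtoC (x : R) : C := (x%:C)%C.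

Definition twopii : C := (0 +i* (2 * pi))%C.

Definition cexp (z : C) : C :=
  (expR (complex.Re z) * cos (complex.Im z)
   +i* (expR (complex.Re z) * sin (complex.Im z)))%C.

(* q^x for a real exponent x, with the branch q^x = e^(2 pi i x t) *)
Definition qpow (x : R) t : C := cexp (twopii * RtoC x * t).

Definition upper t : Prop := 0 < complex.Im t.

(* A meromorphic function on the upper half-plane is represented by a total
   function C -> C. Its values at the poles, on any other closed discrete set,
   and outside the upper half-plane are irrelevant: identities between
   meromorphic functions are read on punctured neighbourhoods. *)
Definition mero_eq f g : Prop :=
  forall t0, upper t0 -> \forall t \near t0^', f t = g t.

Definition meromorphic_at f (t0 : C) : Prop :=
  exists (n : nat) (g : C -> C),
    (\forall t \near t0, derivable g t 1) /\
    (\forall t \near t0^', f t = (t - t0) ^- n * g t).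

Definition meromorphic f : Prop := forall t0, upper t0 -> meromorphic_at f t0.

Definition automorphy gam t : C := (gam 1 0)%:~R * t + (gam 1 1)%:~R.

Definition moebius gam t : C :=
  ((gam 0 0)%:~R * t + (gam 0 1)%:~R) / automorphy gam t.

(* f|_k gam *)
Definition slash k gam f : C -> C := fun t =>
  RtoC ((\det gam)%:~R `^ (k%:~R / 2)) * automorphy gam t ^ (- k)
  * f (moebius gam t).

(* f = \sum_(n >= 0) a_n q^((kappa + n) / h) for Im t large. The real offset
   kappa carries both the (possibly negative) order at i oo and the fractional
   part that a nontrivial multiplier at a cusp produces. *)
Definition fourier_expansion (h : nat) (kappa : R) (a : nat -> C) f : Prop :=
  exists Y : R, forall t0, Y < complex.Im t0 -> upper t0 ->
    \forall t \near t0^',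
      series (fun n => a n * qpow ((kappa + n%:R) / h%:R) t) @ \oo --> f t.

Definition meromorphic_at_cusps k f : Prop :=
  forall gam, SL2Z gam ->
    exists (h : nat) (kappa : R) (a : nat -> C),
      (0 < h)%N /\ fourier_expansion h kappa a (slash k gam f).

Definition modular_with_multiplier (N : nat) k f : Prop :=
  exists chi : 'M[int]_2 -> C,
    (forall gam, Gamma0 N gam -> `|chi gam| = 1) /\
    (forall gam, Gamma0 N gam ->
       mero_eq (fun t => f (moebius gam t))
               (fun t => chi gam * automorphy gam t ^ k * f t)).

Definition integral_leading_one f : Prop :=
  exists (kappa : R) (a : nat -> int),
    a 0%N = 1 /\ fourier_expansion 1 kappa (fun n => (a n)%:~R) f.

(* f belongs to M(N) and has weight k; as f is nonzero, k is unique *)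
Definition in_calM (N : nat) k f : Prop :=
  [/\ meromorphic f, modular_with_multiplier N k f,
      meromorphic_at_cusps k f & integral_leading_one f].

Definition leading_coef_one f : Prop :=
  exists (kappa : R) (a : nat -> C),
    a 0%N = 1 /\ fourier_expansion 1 kappa a f.

(* p^( k/(1-p) * ( (p^(r+1)-p)/(p-1) - r/2 * (p^(r+1)+1) ) ) *)
Definition hecke_factor k (p r : nat) : R :=
  p%:R `^ (k%:~R / (1 - p%:R)
           * ((p%:R ^+ r.+1 - p%:R) / (p%:R - 1)
              - r%:R / 2 * (p%:R ^+ r.+1 + 1))).

(* f|T(p^r) without its normalising constant epsilon *)
Definition hecke_mul_raw k (p r : nat) f : C -> C := fun t =>
  RtoC (hecke_factor k p r)
  * \prod_(d <- divisors (p ^ r)) \prod_(b < d)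
      slash k (mx2 (p ^ r %/ d)%N%:Z (b : nat)%:Z 0 d%:Z) f t.

(* The constant making the leading coefficient 1. For f in M(N) it exists and
   is unique, so the default value 1 of xget is never used there. *)
Definition hecke_eps k (p r : nat) f : C :=
  xget 1 [set e : C | leading_coef_one (fun t => e * hecke_mul_raw k p r f t)].

Definition hecke_mul k (p r : nat) f : C -> C := fun t =>
  hecke_eps k p r f * hecke_mul_raw k p r f t.

(* q d/dq = (2 pi i)^-1 d/dt *)
Definition Theta f : C -> C := fun t => twopii^-1 * f^`()%classic t.

Definition E2 : C -> C := fun t =>
  1 - 24%:R * limn (series (fun n => (sigma n.+1)%:R * qpow 1 t ^+ n.+1)).

(* the weight k of f is passed explicitly *)
Definition frakD k f : C -> C := fun t =>
  Theta f t / f t - k%:~R * E2 t / 12%:R.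

Definition hecke_T2 (n : nat) g : C -> C := fun t =>
  \sum_(d <- divisors n) \sum_(b < d)
     slash 2 (mx2 (n %/ d)%N%:Z (b : nat)%:Z 0 d%:Z) g t.

End ModularForms.

(* Main.v *)
Require Import Defs.
From HB Require Import structures.
From mathcomp Require Import all_boot all_order all_algebra.
From mathcomp Require Import complex.
From mathcomp Require Import all_classical all_reals all_analysis.
From mathcomp Require Import ring lra zify.

(* The logarithmic derivative turns the product defining f|T(p^r) into the sum
   defining T_2(p^r), so up to the E_2 terms both sides agree at every point
   where all the factors f((a t + b)/d) are regular and nonzero; the E_2 terms
   match because E_2 is an eigenfunction of T_2(p^r) with eigenvalue
   sigma(p^r), which on q-expansions is
     sigma(p^r) sigma(M) = sum_(p^i | p^r, M) p^i sigma(p^r M / p^(2i)).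
   That the exceptional points are isolated is the identity theorem for
   meromorphic functions on the upper half-plane (f does not vanish high up
   because its leading coefficient is 1). It is derived from Goursat's theorem
   for rectangles: Cauchy's formula on a square around t0 reads
   G(z) c(z) = N(z) with c(z) and N(z) the integrals of 1/(w - z) and
   G(w)/(w - z). As c and N are visibly differentiable and c(t0) <> 0, isolated
   singularities of continuous functions are removable, so zeros can be
   divided out; the same formula bounds the quotients. *)

Set Implicit Arguments.
Unset Strict Implicit.
Unset Printing Implicit Defensive.

Import Order.TTheory GRing.Theory Num.Theory.
Import numFieldNormedType.Exports.
Local Open Scope classical_set_scope.
Local Open Scope ring_scope.

Local Notation Re := complex.Re.
Local Notation Im := complex.Im.

(** * The complex plane *)

Section ComplexPlane.
Context {R : realType}.
Local Notation C := (Cplx R).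
Implicit Types (z w : C) (x y : R).

(** Contours are boundaries of axis-parallel rectangles, so a contour integral is a combination of
    integrals over real intervals, and cutting a rectangle is additivity of these. One bisection
    principle serves twice: for Goursat's theorem, and with height 0 to carry the nonvanishing of
    [f] along a segment from a point high up to an arbitrary point of the half-plane.

    Constants have logarithmic derivative 0, so the normalising constant, the power of [p] and the
    slash factors enter only through their not being zero. The chain rule for [f ((a t + b) / d)]
    with [a d = n = p^r] produces the factor [a / d = n / d^2], which is the weight 2 factor in
    [T_2(n)]; this is where the passage from weight [k] to weight 2 comes from.

    The eigenvalue equation for [E_2] is proved on partial sums. Averaging over [b] annihilates the
    exponents not divisible by [d], and with cutoffs depending on [d] the two sides agree exactly as
    finite sums. The limit is then taken along a subsequence, and no infinite double series has to
    be rearranged. *)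

Lemma C_ext z w : Re z = Re w -> Im z = Im w -> z = w.
Proof. by case: z; case: w => a b c d /= -> ->. Qed.

(** The norm of [Cplx R] takes its values in [Cplx R]; its real part moves estimates into [R], where
    [lra] and [nra] apply. *)
Definition cabs z : R := Re `|z|.

Lemma normC_cabs z : `|z| = RtoC (cabs z).
Proof. by case: z. Qed.

Lemma RtoCD x y : RtoC (x + y) = RtoC x + RtoC y :> C.
Proof. exact: (rmorphD (real_complex R)). Qed.
Lemma RtoCN x : RtoC (- x) = - RtoC x :> C.
Proof. exact: (rmorphN (real_complex R)). Qed.
Lemma RtoCM x y : RtoC (x * y) = RtoC x * RtoC y :> C.
Proof. exact: (rmorphM (real_complex R)). Qed.
Lemma RtoCV x : RtoC x^-1 = (RtoC x)^-1 :> C.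
Proof. exact: (fmorphV (real_complex R)). Qed.
Lemma RtoCX x n : RtoC (x ^+ n) = RtoC x ^+ n :> C.
Proof. exact: (rmorphXn (real_complex R)). Qed.
Lemma RtoC_nat n : RtoC n%:R = n%:R :> C.
Proof. exact: (rmorph_nat (real_complex R)). Qed.
Lemma RtoC_inj : injective (@RtoC R).
Proof. by move=> x y []. Qed.
Lemma lerRtoC x y : (RtoC x <= RtoC y :> C) = (x <= y).
Proof. exact: lecR. Qed.
Lemma ltrRtoC x y : (RtoC x < RtoC y :> C) = (x < y).
Proof. exact: ltcR. Qed.

Lemma cabsM z w : cabs (z * w) = cabs z * cabs w.
Proof. by apply: RtoC_inj; rewrite RtoCM -!normC_cabs normrM. Qed.
Lemma cabsV z : cabs z^-1 = (cabs z)^-1.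
Proof. by apply: RtoC_inj; rewrite RtoCV -!normC_cabs normfV. Qed.
Lemma cabsX z n : cabs (z ^+ n) = cabs z ^+ n.
Proof. by apply: RtoC_inj; rewrite RtoCX -!normC_cabs normrX. Qed.
Lemma cabsD z w : cabs (z + w) <= cabs z + cabs w.
Proof. by rewrite -lerRtoC RtoCD -!normC_cabs ler_normD. Qed.
Lemma cabsN z : cabs (- z) = cabs z.
Proof. by apply: RtoC_inj; rewrite -!normC_cabs normrN. Qed.
Lemma cabsB z w : cabs (z - w) <= cabs z + cabs w.
Proof. by rewrite (le_trans (cabsD _ _)) // cabsN. Qed.
Lemma cabs_distC z w : cabs (z - w) = cabs (w - z).
Proof. by rewrite -cabsN opprB. Qed.
Lemma cabs_ge0 z : 0 <= cabs z.
Proof. by rewrite -lerRtoC -normC_cabs normr_ge0. Qed.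
Lemma cabs0 : cabs 0 = 0.
Proof. by apply: RtoC_inj; rewrite -normC_cabs normr0. Qed.
Lemma cabs_eq0 z : (cabs z == 0) = (z == 0).
Proof.
apply/eqP/eqP => [h|->]; last exact: cabs0.
by apply/eqP; rewrite -normr_eq0 normC_cabs h.
Qed.
Lemma cabs_gt0 z : (0 < cabs z) = (z != 0).
Proof. by rewrite lt0r cabs_eq0 cabs_ge0 andbT. Qed.
Lemma cabs_RtoC x : cabs (RtoC x) = `|x|.
Proof. by rewrite /cabs normc_def /= expr0n addr0 sqrtr_sqr. Qed.
Lemma cabs_sum (I : Type) (s : seq I) (P : pred I) (F : I -> C) :
  cabs (\sum_(i <- s | P i) F i) <= \sum_(i <- s | P i) cabs (F i).
Proof.
elim/big_rec2 : _ => [|i a b _ h]; first by rewrite cabs0.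
by rewrite (le_trans (cabsD _ _)) // lerD2l.
Qed.
Lemma Re_le_cabs z : `|Re z| <= cabs z.
Proof. by rewrite -lerRtoC -normC_cabs; exact: normc_ge_Re. Qed.
Lemma Im_le_cabs z : `|Im z| <= cabs z.
Proof.
rewrite /cabs normc_def /= -[leLHS]sqrtr_sqr ler_wsqrtr // lerDr.
exact: sqr_ge0.
Qed.
Lemma cabs_le_ReIm z : cabs z <= `|Re z| + `|Im z|.
Proof.
case: z => a b; have -> : (a +i* b)%C = (a +i* 0)%C + (0 +i* b)%C :> C.
  by apply: C_ext; rewrite /= ?addr0 ?add0r.
rewrite (le_trans (cabsD _ _)) // /cabs !normc_def /= expr0n /= !addr0 !add0r.
by rewrite !sqrtr_sqr.
Qed.

Lemma ReD z w : Re (z + w) = Re z + Re w. Proof. by case: z; case: w. Qed.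
Lemma ImD z w : Im (z + w) = Im z + Im w. Proof. by case: z; case: w. Qed.
Lemma ReN z : Re (- z) = - Re z. Proof. by case: z. Qed.
Lemma ImN z : Im (- z) = - Im z. Proof. by case: z. Qed.
Lemma ReM z w : Re (z * w) = Re z * Re w - Im z * Im w.
Proof. by case: z; case: w. Qed.
Lemma ImM z w : Im (z * w) = Re z * Im w + Im z * Re w.
Proof. by case: z; case: w. Qed.
Definition ReImE := (ReD, ImD, ReN, ImN, ReM, ImM).

Lemma gt0_RtoC (e : C) : 0 < e -> exists2 x : R, 0 < x & e = RtoC x.
Proof.
case: e => a b; rewrite ltcE /= => /andP[/eqP b0 a0].
by exists a => //; rewrite b0.
Qed.

Lemma nbhsCP z (P : C -> Prop) : (\forall w \near z, P w) <->
  exists2 e : R, 0 < e & forall w, cabs (w - z) < e -> P w.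
Proof.
split.
  move=> /nbhs_ballP[e /= /gt0_RtoC[x x0 ->]] h; exists x => // w hw; apply: h.
  by rewrite /ball /= distrC normC_cabs ltrRtoC.
case=> e e0 h; apply/nbhs_ballP; exists (RtoC e); first by rewrite /= ltrRtoC.
by move=> w; rewrite /ball /= distrC normC_cabs ltrRtoC; exact: h.
Qed.

Lemma dnbhsCP z (P : C -> Prop) : (\forall w \near z^', P w) <->
  exists2 e : R, 0 < e & forall w, cabs (w - z) < e -> w != z -> P w.
Proof.
rewrite -[X in X <-> _]/(\forall w \near z, w != z -> P w).
exact: nbhsCP.
Qed.

Lemma cvgCP (T : Type) (F : set_system T) (FF : Filter F) (f : T -> C) z :
  (f @ F --> z) <-> (forall e : R, 0 < e -> \forall t \near F, cabs (f t - z) < e).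
Proof.
split.
  move=> /cvgrPdist_lt h e e0; have := h (RtoC e); rewrite ltrRtoC => /(_ e0).
  by apply: filterS => t; rewrite distrC normC_cabs ltrRtoC.
move=> h; apply/cvgrPdist_lt => e /gt0_RtoC[x x0 ->].
by apply: filterS (h x x0) => t; rewrite distrC normC_cabs ltrRtoC.
Qed.

Lemma continuousCP (f : C -> C) z : {for z, continuous f} <->
  forall e, 0 < e -> exists2 d, 0 < d & forall w, cabs (w - z) < d -> cabs (f w - f z) < e.
Proof.
split => [/(@cvgCP _ _ (nbhs_filter z)) h e e0|h].
  by have /nbhsCP := h e e0.
by apply/(@cvgCP _ _ (nbhs_filter z)) => e e0; apply/nbhsCP; exact: h.
Qed.

(** Free of division, and with [<=] so that the condition also holds at [w = z]. The strict
    inequality in the limit is recovered by applying the condition to [e / 2]. *)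
Lemma is_deriveCP (f : C -> C) z l : is_derive z 1 f l <->
  forall e, 0 < e -> exists2 d, 0 < d &
    forall w, cabs (w - z) < d -> cabs (f w - f z - l * (w - z)) <= e * cabs (w - z).
Proof.
have key : (fun h : C => h^-1 *: ((f \o shift z) (h *: 1) - f z)) @ 0^' --> l <->
  forall e, 0 < e -> exists2 d, 0 < d &
    forall w, cabs (w - z) < d -> cabs (f w - f z - l * (w - z)) <= e * cabs (w - z).
  split.
    move=> /cvgCP h e e0; have /dnbhsCP[d d0 hd] := h e e0; exists d => // w hw.
    have [->|wz] := eqVneq w z; first by rewrite !subrr mulr0 subr0 cabs0 mulr0.
    have wz0 : w - z != 0 by rewrite subr_eq0.
    have := hd (w - z); rewrite subr0 => /(_ hw wz0) /=.
    rewrite -[_ *: 1]/((w - z) * 1) mulr1 subrK -[_ *: _]/(_ * _) => hh.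
    have -> : f w - f z - l * (w - z) = ((w - z)^-1 * (f w - f z) - l) * (w - z).
      by rewrite mulrBl mulrAC mulVf // mul1r.
    by rewrite cabsM ler_wpM2r ?cabs_ge0 // ltW.
  move=> h; apply/cvgCP => e e0; apply/dnbhsCP.
  have [d d0 hd] := h (e / 2) (divr_gt0 e0 (ltr0Sn _ _)); exists d => // w.
  rewrite subr0 => hw w0; have := hd (w + z); rewrite addrK => /(_ hw) {}hd.
  rewrite /= -[_ *: 1]/(w * 1) mulr1 -[_ *: _]/(_ * _).
  have -> : w^-1 * (f (w + z) - f z) - l = (f (w + z) - f z - l * w) * w^-1.
    by rewrite mulrBl mulfK // mulrC.
  rewrite cabsM cabsV ltr_pdivrMr ?cabs_gt0 // (le_lt_trans hd) //.
  by rewrite ltr_pM2r ?cabs_gt0 // ltr_pdivrMr // ltr_pMr // ltr1n.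
split.
  case=> df dv; apply/key; rewrite -dv; exact: df.
move=> /key h; apply: DeriveDef; first by apply/cvg_ex; exists l.
by apply: cvg_lim => //.
Qed.

Lemma continuousRe : continuous (fun z : C => Re z).
Proof.
move=> z; apply/(@cvgrPdist_lt _ _ _ _ (nbhs_filter z)) => e e0; apply/nbhsCP; exists e => // w h.
by rewrite -ReN -ReD (le_lt_trans (Re_le_cabs _)) // cabs_distC.
Qed.
Lemma continuousIm : continuous (fun z : C => Im z).
Proof.
move=> z; apply/(@cvgrPdist_lt _ _ _ _ (nbhs_filter z)) => e e0; apply/nbhsCP; exists e => // w h.
by rewrite -ImN -ImD (le_lt_trans (Im_le_cabs _)) // cabs_distC.
Qed.

Lemma derivable_continuous (f : C -> C) z : derivable f z 1 -> {for z, continuous f}.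
Proof. by move/derivable1_diffP/differentiable_continuous. Qed.

End ComplexPlane.

(** * Integration on segments *)

Section Integral.
Context {R : realType}.
Local Notation C := (Cplx R).
Local Notation mu := (@lebesgue_measure R).
Implicit Types (phi psi : R -> C) (a b x y : R) (c : C).

Definition cts_on phi a b := forall x, a <= x <= b -> {for x, continuous phi}.

Definition Cint phi a b : C :=
  ((\int[mu]_(x in `[a, b]) Re (phi x)) +i* (\int[mu]_(x in `[a, b]) Im (phi x)))%C.

Lemma cts_on_integrable (f : R -> R) a b :
  (forall x, a <= x <= b -> {for x, continuous f}) ->
  mu.-integrable `[a, b] (EFin \o f).
Proof.
move=> fc; apply: continuous_compact_integrable; first exact: segment_compact.
apply: continuous_in_subspaceT => x /set_mem /=; rewrite in_itv /=; exact: fc.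
Qed.

Lemma cts_Re phi a b : cts_on phi a b ->
  forall x, a <= x <= b -> {for x, continuous (fun t => Re (phi t))}.
Proof.
by move=> h x xab; apply: continuous_comp; [exact: h|exact: continuousRe].
Qed.
Lemma cts_Im phi a b : cts_on phi a b ->
  forall x, a <= x <= b -> {for x, continuous (fun t => Im (phi t))}.
Proof.
by move=> h x xab; apply: continuous_comp; [exact: h|exact: continuousIm].
Qed.

Let intRe phi a b (h : cts_on phi a b) := cts_on_integrable (cts_Re h).
Let intIm phi a b (h : cts_on phi a b) := cts_on_integrable (cts_Im h).

Lemma eq_Cint phi psi a b : (forall x, a <= x <= b -> phi x = psi x) ->
  Cint phi a b = Cint psi a b.
Proof.
move=> h; rewrite /Cint; congr Complex; apply: eq_Rintegral => x /set_mem /=;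
  by rewrite in_itv /= => /h ->.
Qed.

Lemma CintD phi psi a b : cts_on phi a b -> cts_on psi a b ->
  Cint (fun x => phi x + psi x) a b = Cint phi a b + Cint psi a b.
Proof.
move=> hf hg; apply: C_ext; rewrite !ReImE /=.
  rewrite -RintegralD //; [|exact: intRe|exact: intRe].
  by apply: eq_Rintegral => x _; rewrite ReD.
rewrite -RintegralD //; [|exact: intIm|exact: intIm].
by apply: eq_Rintegral => x _; rewrite ImD.
Qed.

Lemma CintZ phi a b c : cts_on phi a b ->
  Cint (fun x => c * phi x) a b = c * Cint phi a b.
Proof.
move=> hf; have iZr (f : R -> R) k : mu.-integrable `[a, b] (EFin \o f) ->
    mu.-integrable `[a, b] (EFin \o (fun x => k * f x)).
  move=> h; have := @integrableZl _ _ _ mu `[a, b] (measurable_itv _) k _ h.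
  by apply: eq_integrable => // x _ /=; rewrite EFinM.
apply: C_ext; rewrite !ReImE /=.
  rewrite -!RintegralZl //; [|exact: intIm|exact: intRe].
  rewrite -RintegralB //; [|exact/iZr/intRe|exact/iZr/intIm].
  by apply: eq_Rintegral => x _; rewrite ReM.
rewrite -!RintegralZl //; [|exact: intRe|exact: intIm].
rewrite -RintegralD //; [|exact/iZr/intIm|exact/iZr/intRe].
by apply: eq_Rintegral => x _; rewrite ImM.
Qed.

Lemma Rintegral_itv_cst a b x : a <= b -> \int[mu]_(_ in `[a, b]) x = x * (b - a).
Proof.
move=> ab; rewrite Rintegral_cst //= lebesgue_measure_itv /= lte_fin.
by move: ab; rewrite le_eqVlt => /predU1P[->|->] //=; rewrite ltxx subrr.
Qed.

Lemma Cint_cst c a b : a <= b -> Cint (fun=> c) a b = RtoC (b - a) * c.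
Proof.
move=> ab; rewrite /Cint !Rintegral_itv_cst //; apply: C_ext; rewrite ReImE /=.
  by rewrite mul0r subr0 mulrC.
by rewrite mul0r addr0 mulrC.
Qed.

Lemma Rintegral_itv_cat (f : R -> R) a m b : a <= m <= b ->
  mu.-integrable `[a, b] (EFin \o f) ->
  \int[mu]_(x in `[a, b]) f x =
  \int[mu]_(x in `[a, m]) f x + \int[mu]_(x in `[m, b]) f x.
Proof.
move=> /andP[am mb] fi.
have := @Rintegral_itvB R f (BLeft a) (BRight b) m fi.
rewrite !bnd_simp => /(_ am mb) /eqP; rewrite subr_eq addrC => /eqP ->.
congr (_ + _); apply: Rintegral_itv_obnd_cbnd.
apply: integrableS fi => //; apply: subset_itvr; by rewrite bnd_simp.
Qed.

Lemma Cint_cat phi a m b : a <= m <= b -> cts_on phi a b ->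
  Cint phi a b = Cint phi a m + Cint phi m b.
Proof.
move=> amb h; apply: C_ext; rewrite ReImE /=; apply: Rintegral_itv_cat => //.
  exact: intRe.
exact: intIm.
Qed.

Lemma Rintegral_itv_bound (f : R -> R) a b M : a <= b ->
  (forall x, a <= x <= b -> {for x, continuous f}) ->
  (forall x, a <= x <= b -> `|f x| <= M) ->
  `|\int[mu]_(x in `[a, b]) f x| <= M * (b - a).
Proof.
move=> ab fc fM; have fi := cts_on_integrable fc.
apply: le_trans (le_normr_Rintegral _ fi) _ => //.
rewrite -Rintegral_itv_cst //; apply: le_Rintegral => //.
- apply: cts_on_integrable => x xab.
  apply: continuous_comp; [exact: fc|exact: norm_continuous].
- by apply: cts_on_integrable => x _; exact: cst_continuous.
Qed.

(** The factor 2 comes from bounding the real and the imaginary part separately by [M]. *)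
Lemma Cint_bound phi a b M : a <= b -> cts_on phi a b ->
  (forall x, a <= x <= b -> cabs (phi x) <= M) ->
  cabs (Cint phi a b) <= 2 * M * (b - a).
Proof.
move=> ab h hM; rewrite (le_trans (cabs_le_ReIm _)) //=.
have -> : 2 * M * (b - a) = M * (b - a) + M * (b - a) by ring.
rewrite lerD //.
  apply: Rintegral_itv_bound => // x xab; first exact: (cts_Re h).
  by rewrite (le_trans (Re_le_cabs _)) // hM.
apply: Rintegral_itv_bound => // x xab; first exact: (cts_Im h).
by rewrite (le_trans (Im_le_cabs _)) // hM.
Qed.

End Integral.

(** * Goursat's theorem for rectangles *)

Section Goursat.
Context {R : realType}.
Local Notation C := (Cplx R).
Implicit Types (F G : C -> C) (a b x y : R) (c l : C) (P : C -> Prop).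

Definition pt x y : C := (x +i* y)%C.

Lemma cabs_pt_le x y a b : cabs (pt x y - pt a b) <= `|x - a| + `|y - b|.
Proof. by rewrite (le_trans (cabs_le_ReIm _)) // !ReImE. Qed.

Lemma continuous_ptx y : continuous (fun x => pt x y : C).
Proof.
move=> x; apply/(@cvgCP _ _ _ (nbhs_filter x)) => e e0.
near=> t; rewrite (le_lt_trans (cabs_pt_le _ _ _ _)) // subrr normr0 addr0 distrC.
near: t; exact: cvgr_dist_lt.
Unshelve. all: by end_near. Qed.

Lemma continuous_pty x : continuous (fun y => pt x y : C).
Proof.
move=> y; apply/(@cvgCP _ _ _ (nbhs_filter y)) => e e0.
near=> t; rewrite (le_lt_trans (cabs_pt_le _ _ _ _)) // subrr normr0 add0r distrC.
near: t; exact: cvgr_dist_lt.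
Unshelve. all: by end_near. Qed.

Definition on_bd P x0 x1 y0 y1 :=
  (forall x, x0 <= x <= x1 -> P (pt x y0) /\ P (pt x y1)) /\
  (forall y, y0 <= y <= y1 -> P (pt x0 y) /\ P (pt x1 y)).

Definition in_rect P x0 x1 y0 y1 :=
  forall x y, x0 <= x <= x1 -> y0 <= y <= y1 -> P (pt x y).

Definition cts G z := {for z, continuous G}.

(** The counterclockwise contour integral: bottom minus top, plus [i] times right minus left.
    Opposite sides share one integral, so cancellations between them happen under the integral
    sign. *)
Definition rint G x0 x1 y0 y1 : C :=
  Cint (fun x => G (pt x y0) - G (pt x y1)) x0 x1
  + (0 +i* 1)%C * Cint (fun y => G (pt x1 y) - G (pt x0 y)) y0 y1.

Lemma in_rect_bd P x0 x1 y0 y1 : x0 <= x1 -> y0 <= y1 ->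
  in_rect P x0 x1 y0 y1 -> on_bd P x0 x1 y0 y1.
Proof.
move=> x01 y01 h; split => t ht; split; apply: h => //; by rewrite ?lexx ?x01 ?y01.
Qed.

Lemma sub_rect P x0 x1 y0 y1 x0' x1' y0' y1' :
  x0 <= x0' -> x1' <= x1 -> y0 <= y0' -> y1' <= y1 ->
  in_rect P x0 x1 y0 y1 -> in_rect P x0' x1' y0' y1'.
Proof. by move=> ? ? ? ? h x y ? ?; apply: h; lra. Qed.

Lemma cts_onx G x0 x1 y : (forall x, x0 <= x <= x1 -> cts G (pt x y)) ->
  cts_on (fun x => G (pt x y)) x0 x1.
Proof.
move=> h x hx; apply: (@continuous_comp _ _ _ (fun x => pt x y)); last exact: h.
exact: continuous_ptx.
Qed.

Lemma cts_ony G x y0 y1 : (forall y, y0 <= y <= y1 -> cts G (pt x y)) ->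
  cts_on (fun y => G (pt x y)) y0 y1.
Proof.
move=> h y hy; apply: (@continuous_comp _ _ _ (fun y => pt x y)); last exact: h.
exact: continuous_pty.
Qed.

Lemma cts_onB (phi psi : R -> C) a b : cts_on phi a b -> cts_on psi a b ->
  cts_on (fun x => phi x - psi x) a b.
Proof. by move=> h1 h2 x hx; apply: continuousB; [exact: h1|exact: h2]. Qed.

Lemma bd_cts_onx G x0 x1 y0 y1 : on_bd (cts G) x0 x1 y0 y1 ->
  cts_on (fun x => G (pt x y0) - G (pt x y1)) x0 x1.
Proof. by case=> h _; apply: cts_onB; apply: cts_onx => x /h []. Qed.

Lemma bd_cts_ony G x0 x1 y0 y1 : on_bd (cts G) x0 x1 y0 y1 ->
  cts_on (fun y => G (pt x1 y) - G (pt x0 y)) y0 y1.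
Proof. by case=> _ h; apply: cts_onB; apply: cts_ony => x /h []. Qed.

Lemma eq_rint F G x0 x1 y0 y1 : on_bd (fun z => F z = G z) x0 x1 y0 y1 ->
  rint F x0 x1 y0 y1 = rint G x0 x1 y0 y1.
Proof.
by case=> h1 h2; congr (_ + _ * _); apply: eq_Cint => t;
  [move=> /h1[-> ->]|move=> /h2[-> ->]].
Qed.

Lemma rintD F G x0 x1 y0 y1 :
  on_bd (cts F) x0 x1 y0 y1 -> on_bd (cts G) x0 x1 y0 y1 ->
  rint (fun z => F z + G z) x0 x1 y0 y1 = rint F x0 x1 y0 y1 + rint G x0 x1 y0 y1.
Proof.
move=> hF hG; rewrite /rint addrACA -mulrDr -!CintD;
  try solve [exact: bd_cts_onx | exact: bd_cts_ony].
by congr (_ + _ * _); apply: eq_Cint => t _; rewrite opprD addrACA.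
Qed.

Lemma rintZ c G x0 x1 y0 y1 : on_bd (cts G) x0 x1 y0 y1 ->
  rint (fun z => c * G z) x0 x1 y0 y1 = c * rint G x0 x1 y0 y1.
Proof.
move=> hG; rewrite /rint mulrDr mulrCA -!(@CintZ _ _ _ _ c);
  try solve [exact: bd_cts_onx | exact: bd_cts_ony].
by congr (_ + _ * _); apply: eq_Cint => t _; rewrite mulrBr.
Qed.

Lemma cabs_i : cabs (0 +i* 1 : C)%C = 1.
Proof. by rewrite /cabs normc_def /= expr0n expr1n add0r sqrtr1. Qed.

Lemma rint_bound G x0 x1 y0 y1 M : x0 <= x1 -> y0 <= y1 ->
  on_bd (cts G) x0 x1 y0 y1 -> on_bd (fun z => cabs (G z) <= M) x0 x1 y0 y1 ->
  cabs (rint G x0 x1 y0 y1) <= 4 * M * ((x1 - x0) + (y1 - y0)).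
Proof.
move=> x01 y01 hG [h1 h2]; rewrite (le_trans (cabsD _ _)) // cabsM cabs_i mul1r.
have bnd z w : cabs (G z) <= M -> cabs (G w) <= M -> cabs (G z - G w) <= 2 * M.
  by move=> hz hw; rewrite (le_trans (cabsB _ _)) //; lra.
have : cabs (Cint (fun x => G (pt x y0) - G (pt x y1)) x0 x1) <= 2 * (2 * M) * (x1 - x0).
  by apply: Cint_bound => // [|x /h1[? ?]]; [exact: bd_cts_onx|exact: bnd].
have : cabs (Cint (fun y => G (pt x1 y) - G (pt x0 y)) y0 y1) <= 2 * (2 * M) * (y1 - y0).
  by apply: Cint_bound => // [|x /h2[? ?]]; [exact: bd_cts_ony|exact: bnd].
lra.
Qed.

Lemma rint_vcut G x0 m x1 y0 y1 : x0 <= m <= x1 -> y0 <= y1 ->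
  in_rect (cts G) x0 x1 y0 y1 ->
  rint G x0 x1 y0 y1 = rint G x0 m y0 y1 + rint G m x1 y0 y1.
Proof.
move=> /andP[x0m mx1] y01 h; have x01 : x0 <= x1 by lra.
rewrite /rint (@Cint_cat _ _ _ m); first last.
- exact/bd_cts_onx/in_rect_bd.
- by rewrite x0m.
rewrite addrACA -mulrDr -CintD.
- congr (_ + _ * _); apply: eq_Cint => y _; ring.
- apply: bd_cts_ony (in_rect_bd _ _ _) => //; exact: sub_rect h.
- apply: bd_cts_ony (in_rect_bd _ _ _) => //; exact: sub_rect h.
Qed.

Lemma rint_hcut G x0 x1 y0 m y1 : x0 <= x1 -> y0 <= m <= y1 ->
  in_rect (cts G) x0 x1 y0 y1 ->
  rint G x0 x1 y0 y1 = rint G x0 x1 y0 m + rint G x0 x1 m y1.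
Proof.
move=> x01 /andP[y0m my1] h; have y01 : y0 <= y1 by lra.
rewrite /rint (@Cint_cat _ _ y0 m y1); first last.
- exact/bd_cts_ony/in_rect_bd.
- by rewrite y0m.
rewrite addrACA -mulrDr -CintD.
- congr (_ + _ * _); apply: eq_Cint => y _; ring.
- apply: bd_cts_onx (in_rect_bd _ _ _) => //; exact: sub_rect h.
- apply: bd_cts_onx (in_rect_bd _ _ _) => //; exact: sub_rect h.
Qed.

Lemma rint_quarter G x0 xm x1 y0 ym y1 : x0 <= xm <= x1 -> y0 <= ym <= y1 ->
  in_rect (cts G) x0 x1 y0 y1 ->
  rint G x0 x1 y0 y1 = (rint G x0 xm y0 ym + rint G x0 xm ym y1)
                       + (rint G xm x1 y0 ym + rint G xm x1 ym y1).
Proof.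
move=> hx hy h; have /andP[h1 h2] := hx; have /andP[h3 h4] := hy.
rewrite (rint_vcut hx (le_trans h3 h4) h).
rewrite (rint_hcut h1 hy (sub_rect (lexx _) h2 (lexx _) (lexx _) h)).
by rewrite (rint_hcut h2 hy (sub_rect h1 (lexx _) (lexx _) (lexx _) h)).
Qed.

(** Values on opposite sides differ by a constant; the two pairs contribute
    [- i l (x1 - x0) (y1 - y0)] and its negative. *)
Lemma rint_affine c l x0 x1 y0 y1 : x0 <= x1 -> y0 <= y1 ->
  rint (fun z => c + l * z) x0 x1 y0 y1 = 0.
Proof.
move=> x01 y01; rewrite /rint.
rewrite (@eq_Cint _ _ (fun=> l * (0 +i* 1)%C * RtoC (y0 - y1))); last first.
  by move=> x _; apply: C_ext; rewrite !ReImE /=; ring.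
rewrite (@eq_Cint _ (fun y => _ - _) (fun=> l * RtoC (x1 - x0))); last first.
  by move=> x _; apply: C_ext; rewrite !ReImE /=; ring.
rewrite !Cint_cst //; apply: C_ext; rewrite !ReImE /=; ring.
Qed.

Lemma le0_small (a K d : R) : 0 < d -> (forall e, 0 < e < d -> a <= e * K) -> a <= 0.
Proof.
move=> d0 h; rewrite leNgt; apply/negP => a0.
have K0 : 0 < `|K| + 1 by rewrite ltr_wpDl.
(* With this choice [e * K < a / 2], against [a <= e * K]. *)
pose e := Num.min (d / 2) (a / (2 * (`|K| + 1))).
have e0 : 0 < e by rewrite lt_min !divr_gt0 // mulr_gt0.
have ed : e < d.
  by rewrite (@le_lt_trans _ _ (d / 2)) ?ge_min ?lexx // ltr_pdivrMr // ltr_pMr // ltr1n.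
have := h e; rewrite e0 ed => /(_ isT) h1.
have h2 : e * (2 * (`|K| + 1)) <= a.
  by rewrite -ler_pdivlMr ?mulr_gt0 // ge_min lexx orbT.
have h3 : e * K <= e * `|K| by rewrite ler_pM2l // ler_norm.
nra.
Qed.

Lemma nested_intervals (x X : nat -> R) :
  (forall n, x n <= x n.+1) -> (forall n, X n.+1 <= X n) -> (forall n, x n <= X n) ->
  exists u, forall n, x n <= u <= X n.
Proof.
move=> xi Xd xX.
have xm m n : (m <= n)%N -> x m <= x n by move=> mn; exact: (nondecreasing_seqP _).1.
have Xm m n : (m <= n)%N -> X n <= X m by move=> mn; exact: (nonincreasing_seqP _).1.
have xXmn m n : x m <= X n.
  have [mn|/ltnW nm] := leqP m n; first exact: le_trans (xm _ _ mn) (xX n).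
  exact: le_trans (xX m) (Xm _ _ nm).
exists (sup (range x)) => n; apply/andP; split.
  apply: sup_upper_bound; last by exists n.
  split; first by exists (x 0%N), 0%N.
  by exists (X 0%N) => _ [m _ <-].
by apply: ge_sup; [exists (x 0%N), 0%N|move=> _ [m _ <-]].
Qed.

(* Cousin's lemma for the rectangles [x, x + sA] x [y, y + sB] *)
Lemma rect_bisection (P : R -> R -> R -> Prop) (A B x0 y0 : R) :
  0 <= A -> 0 <= B ->
  (forall x y s, 0 < s -> P x y (s / 2) -> P (x + s / 2 * A) y (s / 2) ->
     P x (y + s / 2 * B) (s / 2) -> P (x + s / 2 * A) (y + s / 2 * B) (s / 2) ->
     P x y s) ->
  (forall u v, x0 <= u <= x0 + A -> y0 <= v <= y0 + B ->
     exists2 d, 0 < d & forall x y s, 0 < s < d ->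
       x <= u <= x + s * A -> y <= v <= y + s * B -> P x y s) ->
  P x0 y0 1.
Proof.
move=> A0 B0 split_P loc; apply: contrapT => nP.
(* If [P] fails at scale [s], it fails on one of the quarters, and [w] is the corner of that
   quarter. The hypotheses stand below the existential so that [cid] yields a total function
   [next]. *)
have step (z : R * R) (s : R) : exists w : R * R, 0 < s -> ~ P z.1 z.2 s ->
    [/\ ~ P w.1 w.2 (s / 2), z.1 <= w.1 <= z.1 + s / 2 * A
       & z.2 <= w.2 <= z.2 + s / 2 * B].
  have [s0|] := pselect (0 < s); last by exists z.
  have sA : 0 <= s / 2 * A by rewrite !mulr_ge0 // ltW.
  have sB : 0 <= s / 2 * B by rewrite !mulr_ge0 // ltW.
  have [?|] := pselect (P z.1 z.2 (s / 2)); last first.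
    by move=> ?; exists (z.1, z.2) => _ _; split => //=; lra.
  have [?|] := pselect (P (z.1 + s / 2 * A) z.2 (s / 2)); last first.
    by move=> ?; exists (z.1 + s / 2 * A, z.2) => _ _; split => //=; lra.
  have [?|] := pselect (P z.1 (z.2 + s / 2 * B) (s / 2)); last first.
    by move=> ?; exists (z.1, z.2 + s / 2 * B) => _ _; split => //=; lra.
  have [?|] := pselect (P (z.1 + s / 2 * A) (z.2 + s / 2 * B) (s / 2)); last first.
    by move=> ?; exists (z.1 + s / 2 * A, z.2 + s / 2 * B) => _ _; split => //=; lra.
  by exists z => _ []; exact: split_P.
pose next z s := sval (cid (step z s)).
have nextP z s := svalP (cid (step z s)).
pose fix Z n := if n is m.+1 then next (Z m) (2^-1 ^+ m) else (x0, y0).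
have s0 n : 0 < (2^-1 : R) ^+ n by rewrite exprn_gt0 // invr_gt0.
have sS n : (2^-1 : R) ^+ n.+1 = 2^-1 ^+ n / 2 by rewrite exprSr.
have Zn n : ~ P (Z n).1 (Z n).2 (2^-1 ^+ n).
  elim: n => [|n IH]; first by rewrite expr0.
  by rewrite sS; have [] := nextP (Z n) _ (s0 n) IH.
have Zs n : (Z n).1 <= (Z n.+1).1 <= (Z n).1 + 2^-1 ^+ n / 2 * A /\
            (Z n).2 <= (Z n.+1).2 <= (Z n).2 + 2^-1 ^+ n / 2 * B.
  by have [] := nextP (Z n) _ (s0 n) (Zn n).
have [u hu] : exists u, forall n, (Z n).1 <= u <= (Z n).1 + 2^-1 ^+ n * A.
  apply: nested_intervals => n; first by have [/andP[]] := Zs n.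
    by rewrite sS; have [/andP[_]] := Zs n; lra.
  by rewrite lerDl mulr_ge0 // ltW.
have [v hv] : exists v, forall n, (Z n).2 <= v <= (Z n).2 + 2^-1 ^+ n * B.
  apply: nested_intervals => n; first by have [_ /andP[]] := Zs n.
    by rewrite sS; have [_ /andP[_]] := Zs n; lra.
  by rewrite lerDl mulr_ge0 // ltW.
have [d d0 hd] : exists2 d, 0 < d & forall x y s, 0 < s < d ->
       x <= u <= x + s * A -> y <= v <= y + s * B -> P x y s.
  apply: loc.
    by have := hu 0%N; rewrite expr0 mul1r.
  by have := hv 0%N; rewrite expr0 mul1r.
have [n nd] : exists n, (2^-1 : R) ^+ n < d.
  have : (2^-1 : R) ^+ n @[n --> \oo] --> 0.
    by apply: cvg_expr; rewrite ger0_norm ?invr_ge0 // invf_lt1 // ltr1n.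
  move/cvgrPdist_lt => /(_ d d0)[n _ /(_ n (leqnn n))].
  by rewrite sub0r normrN ger0_norm ?ltW //; exists n.
apply: (Zn n); apply: hd => //; by rewrite s0.
Qed.

(** The bounds [e * 4 (A + B)^2 * s^2] of the four quarters add up to the bound of the whole, so by
    bisection only small rectangles around a given point matter. There the affine approximation [H2]
    integrates to 0 and the remainder [H1] is at most [e * s * (A + B)] on the boundary. Finally [e]
    tends to 0. *)
Lemma goursat G x0 x1 y0 y1 : x0 <= x1 -> y0 <= y1 ->
  in_rect (fun z => derivable G z 1) x0 x1 y0 y1 -> rint G x0 x1 y0 y1 = 0.
Proof.
move=> x01 y01 hG.
have Gc : in_rect (cts G) x0 x1 y0 y1.
  by move=> x y hx hy; apply: derivable_continuous; exact: hG.
pose A := x1 - x0; pose B := y1 - y0.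
have A0 : 0 <= A by rewrite subr_ge0.
have B0 : 0 <= B by rewrite subr_ge0.
apply/eqP; rewrite -cabs_eq0 eq_le cabs_ge0 andbT.
apply: (@le0_small _ (4 * (A + B) ^+ 2) 1) => // e /andP[e0 _].
(* Containment in the given rectangle is part of [P], since bisection speaks of all [x], [y], [s]
   while [G] is controlled only there. *)
pose P x y s := x0 <= x -> x + s * A <= x1 -> y0 <= y -> y + s * B <= y1 ->
  cabs (rint G x (x + s * A) y (y + s * B)) <= e * (4 * (A + B) ^+ 2) * s ^+ 2.
have : P x0 y0 1; last first.
  rewrite /P !mul1r expr1n mulr1 /A /B !subrKC; exact.
apply: (@rect_bisection _ A B) => //.
  move=> x y s s0; rewrite /P => P1 P2 P3 P4 h1 h2 h3 h4.
  have sA : 0 <= s / 2 * A by rewrite !mulr_ge0 // ltW.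
  have sB : 0 <= s / 2 * B by rewrite !mulr_ge0 // ltW.
  have eA : x + s / 2 * A + s / 2 * A = x + s * A by field.
  have eB : y + s / 2 * B + s / 2 * B = y + s * B by field.
  move: P1 P2 P3 P4; rewrite eA eB => P1 P2 P3 P4.
  have lx : x <= x + s / 2 * A by rewrite lerDl.
  have xl : x + s / 2 * A <= x + s * A by rewrite -eA lerDl.
  have ly : y <= y + s / 2 * B by rewrite lerDl.
  have yl : y + s / 2 * B <= y + s * B by rewrite -eB lerDl.
  rewrite (@rint_quarter _ _ (x + s / 2 * A) _ _ (y + s / 2 * B)) ?lx ?xl ?ly ?yl //;
    last exact: (sub_rect h1 h2 h3 h4 Gc).
  have {}P1 := P1 h1 (le_trans xl h2) h3 (le_trans yl h4).
  have {}P2 := P2 (le_trans h1 lx) h2 h3 (le_trans yl h4).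
  have {}P3 := P3 h1 (le_trans xl h2) (le_trans h3 ly) h4.
  have {}P4 := P4 (le_trans h1 lx) h2 (le_trans h3 ly) h4.
  rewrite (le_trans (cabsD _ _)) //.
  have := lerD (le_trans (cabsD _ _) (lerD P1 P3)) (le_trans (cabsD _ _) (lerD P2 P4)).
  move=> h; apply: le_trans h _.
  by rewrite le_eqVlt; apply/orP; left; apply/eqP; field.
move=> u v hu hv.
have hw : derivable G (pt u v) 1 by apply: hG; move: hu hv; rewrite /A /B; lra.
have [d d0 hd] := (@is_deriveCP _ G _ _).1 (derivableP hw) e e0.
set l := 'D_1 G (pt u v) in hd.
have AB0 : 0 < A + B + 1 by lra.
(* All points of a rectangle of scale [s] lie within [s * (A + B) < d] of [pt u v]; the [+ 1] keeps
   the denominator positive for a degenerate rectangle. *)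
exists (d / (A + B + 1)) => [|x y s /andP[s0]]; first by rewrite divr_gt0.
rewrite ltr_pdivlMr // => sd hu' hv' h1 h2 h3 h4.
have sA : 0 <= s * A by rewrite mulr_ge0 // ltW.
have sB : 0 <= s * B by rewrite mulr_ge0 // ltW.
have cQ : in_rect (cts G) x (x + s * A) y (y + s * B) by exact: sub_rect Gc.
have affc c' l' z : cts (fun z => c' + l' * z) z.
  apply: continuousD; first exact: cst_continuous.
  by apply: continuousM; [exact: cst_continuous|exact: cvg_id].
have bdc F' : in_rect (cts F') x (x + s * A) y (y + s * B) ->
    on_bd (cts F') x (x + s * A) y (y + s * B).
  by apply: in_rect_bd; lra.
pose H1 z := G z + ((- G (pt u v) + l * pt u v) + (- l) * z).
pose H2 z := (G (pt u v) - l * pt u v) + l * z.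
have cH1 : on_bd (cts H1) x (x + s * A) y (y + s * B).
  by apply: (bdc H1) => a b ha hb; apply: continuousD; [exact: cQ|exact: affc].
have cH2 : on_bd (cts H2) x (x + s * A) y (y + s * B).
  by apply: (bdc H2) => a b ha hb; exact: affc.
have -> : rint G x (x + s * A) y (y + s * B) = rint H1 x (x + s * A) y (y + s * B).
  have H20 : rint H2 x (x + s * A) y (y + s * B) = 0.
    by apply: rint_affine; rewrite lerDl.
  rewrite -[RHS]addr0 -H20 -(rintD cH1 cH2).
  by apply: eq_rint; split => t _; rewrite /H1 /H2; split; ring.
apply: le_trans (rint_bound (M := e * (s * (A + B))) _ _ _ _) _; first lra.
- lra.
- exact: cH1.
- apply: in_rect_bd; [lra|lra|move=> a b ha hb].
  rewrite /H1; have -> : G (pt a b) + (- G (pt u v) + l * pt u v + - l * pt a b)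
     = G (pt a b) - G (pt u v) - l * (pt a b - pt u v) by ring.
  have hab : cabs (pt a b - pt u v) <= s * (A + B).
    rewrite (le_trans (cabs_pt_le _ _ _ _)) // mulrDr lerD // ler_norml; lra.
  rewrite (le_trans (hd _ _)) // ?(le_lt_trans hab) //; first lra.
  by rewrite ler_pM2l.
- rewrite le_eqVlt; apply/orP; left; apply/eqP; ring.
Qed.

End Goursat.

(** * Goursat's theorem with finitely many exceptional points *)

Section Cauchy.
Context {R : realType}.
Local Notation C := (Cplx R).
Implicit Types (F G : C -> C) (a b x y : R) (c l : C) (P : C -> Prop).

(* An exceptional point contributes nothing: the integral around a square of
   side [2 * d] centred at it is [O(d)] when [G] is merely bounded there. *)
Lemma goursat_except (E : seq C) G x0 x1 y0 y1 : x0 <= x1 -> y0 <= y1 ->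
  in_rect (cts G) x0 x1 y0 y1 ->
  in_rect (fun z => z \notin E -> derivable G z 1) x0 x1 y0 y1 ->
  rint G x0 x1 y0 y1 = 0.
Proof.
elim: E x0 x1 y0 y1 => [|e E IH] x0 x1 y0 y1 x01 y01 hc hd.
  by apply: (goursat x01 y01) => x y hx hy; apply: (hd x y).
have IHn x0' x1' y0' y1' : x0' <= x1' -> y0' <= y1' ->
    in_rect (cts G) x0' x1' y0' y1' ->
    in_rect (fun z => z \notin e :: E -> derivable G z 1) x0' x1' y0' y1' ->
    in_rect (fun z => z != e) x0' x1' y0' y1' -> rint G x0' x1' y0' y1' = 0.
  move=> h1 h2 h3 h4 h5; apply: (IH _ _ _ _ h1 h2 h3) => x y hx hy nE.
  apply: (h4 _ _ hx hy).
  by rewrite inE negb_or h5.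
have [ein|eout] := pselect (x0 <= Re e <= x1 /\ y0 <= Im e <= y1); last first.
  apply: (IHn _ _ _ _ x01 y01 hc hd) => x y hx hy; apply/eqP => ez.
  apply: eout; rewrite -ez.
  by split.
have ece : cts G e.
  by have := hc _ _ ein.1 ein.2; rewrite /pt -(_ : e = (Re e +i* Im e)%C); [|case: (e)].
have [d d0 hd1] := (continuousCP G e).1 ece 1 ltr01.
apply/eqP; rewrite -cabs_eq0 eq_le cabs_ge0 andbT.
have d20 : 0 < d / 2 by rewrite divr_gt0.
(* [16] is the 4 of [rint_bound] times the bound [4 * s] for width plus height. As [s < d / 2], the
   small rectangle stays within distance [d] of [e], where [cabs (G z) <= cabs (G e) + 1]. *)
apply: (le0_small (K := 16 * (cabs (G e) + 1)) d20) => s /andP[s0 sd].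
(* The square of half side [s] around [e] is clipped to the given rectangle. Each of the four strips
   cut off either is degenerate or avoids [e], so its integral is 0. *)
pose xa := Num.max x0 (Re e - s); pose xb := Num.min x1 (Re e + s).
pose ya := Num.max y0 (Im e - s); pose yb := Num.min y1 (Im e + s).
case: ein => /andP[ex0 ex1] /andP[ey0 ey1].
have hxa : x0 <= xa <= Re e by rewrite le_max ge_max lexx ex0 /=; lra.
have hxb : Re e <= xb <= x1 by rewrite le_min ge_min lexx ex1 /=; lra.
have hya : y0 <= ya <= Im e by rewrite le_max ge_max lexx ey0 /=; lra.
have hyb : Im e <= yb <= y1 by rewrite le_min ge_min lexx ey1 /=; lra.
have xae : Re e - s <= xa by rewrite le_max lexx orbT.
have xbe : xb <= Re e + s by rewrite ge_min lexx orbT.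
have yae : Im e - s <= ya by rewrite le_max lexx orbT.
have ybe : yb <= Im e + s by rewrite ge_min lexx orbT.
have {}hxa : [/\ x0 <= xa, xa <= Re e & (xa = x0 \/ xa = Re e - s)].
  case/andP: hxa => -> ->; split => //; rewrite /xa.
  by case: leP => _; [right|left].
have {}hya : [/\ y0 <= ya, ya <= Im e & (ya = y0 \/ ya = Im e - s)].
  case/andP: hya => -> ->; split => //; rewrite /ya.
  by case: leP => _; [right|left].
have {}hxb : [/\ Re e <= xb, xb <= x1 & (xb = x1 \/ xb = Re e + s)].
  case/andP: hxb => -> ->; split => //; rewrite /xb.
  by case: leP => _; [left|right].
have {}hyb : [/\ Im e <= yb, yb <= y1 & (yb = y1 \/ yb = Im e + s)].
  case/andP: hyb => -> ->; split => //; rewrite /yb.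
  by case: leP => _; [left|right].
move: xa xb ya yb xae xbe yae ybe hxa hxb hya hyb => xa xb ya yb xae xbe yae ybe.
case=> x0a xae' xa_or [exb xb1 xb_or] [y0a yae' ya_or] [eyb yb1 yb_or].
have xab : xa <= xb by exact: le_trans exb.
have yab : ya <= yb by exact: le_trans eyb.
have xa1 : xa <= x1 by exact: le_trans xb1.
have ya1 : ya <= y1 by exact: le_trans yb1.
have hc1 := sub_rect x0a (lexx x1) (lexx y0) (lexx y1) hc.
have hd1' := sub_rect x0a (lexx x1) (lexx y0) (lexx y1) hd.
have hc2 := sub_rect (lexx xa) xb1 (lexx y0) (lexx y1) hc1.
have hd2 := sub_rect (lexx xa) xb1 (lexx y0) (lexx y1) hd1'.
have hc3 := sub_rect (lexx xa) (lexx xb) y0a (lexx y1) hc2.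
have hd3 := sub_rect (lexx xa) (lexx xb) y0a (lexx y1) hd2.
(* Cutting a degenerate rectangle at its only abscissa gives [I = I + I]. *)
have degx x : x0 <= x <= x1 -> rint G x x y0 y1 = 0.
  move=> /andP[hx1 hx2]; have h := sub_rect hx1 hx2 (lexx y0) (lexx y1) hc.
  have xx : x <= x <= x by rewrite lexx.
  have := rint_vcut xx y01 h => /eqP.
  by rewrite -subr_eq0 opprD addNKr oppr_eq0 => /eqP.
have degy y : y0 <= y <= y1 -> rint G xa xb y y = 0.
  move=> /andP[hy1 hy2]; have h := sub_rect (lexx xa) (lexx xb) hy1 hy2 hc2.
  have yy : y <= y <= y by rewrite lexx.
  have := rint_hcut xab yy h => /eqP.
  by rewrite -subr_eq0 opprD addNKr oppr_eq0 => /eqP.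
have neRe x y : x != Re e -> pt x y != e.
  by apply: contraNneq => <-.
have neIm x y : y != Im e -> pt x y != e.
  by apply: contraNneq => <-.
have x0a1 : x0 <= xa <= x1 by rewrite x0a.
rewrite (rint_vcut x0a1 y01 hc).
have -> : rint G x0 xa y0 y1 = 0.
  have [->|xaE] := xa_or; first by rewrite degx ?lexx.
  apply: (IHn _ _ _ _ x0a y01 (sub_rect (lexx _) xa1 (lexx _) (lexx _) hc)
    (sub_rect (lexx _) xa1 (lexx _) (lexx _) hd)).
  by move=> x y hx _; apply: neRe; lra.
have xab1 : xa <= xb <= x1 by rewrite xab.
rewrite (rint_vcut xab1 y01 hc1).
have -> : rint G xb x1 y0 y1 = 0.
  have [->|xbE] := xb_or; first by rewrite degx ?lexx ?x01.
  apply: (IHn _ _ _ _ xb1 y01 (sub_rect xab (lexx _) (lexx _) (lexx _) hc1)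
    (sub_rect xab (lexx _) (lexx _) (lexx _) hd1')).
  by move=> x y hx _; apply: neRe; lra.
have y0a1 : y0 <= ya <= y1 by rewrite y0a.
rewrite (rint_hcut xab y0a1 hc2).
have -> : rint G xa xb y0 ya = 0.
  have [->|yaE] := ya_or; first by rewrite degy ?lexx.
  apply: (IHn _ _ _ _ xab y0a (sub_rect (lexx _) (lexx _) (lexx _) ya1 hc2)
    (sub_rect (lexx _) (lexx _) (lexx _) ya1 hd2)).
  by move=> x y _ hy; apply: neIm; lra.
have yab1 : ya <= yb <= y1 by rewrite yab.
rewrite (rint_hcut xab yab1 hc3).
have -> : rint G xa xb yb y1 = 0.
  have [->|ybE] := yb_or; first by rewrite degy ?lexx ?y01.
  apply: (IHn _ _ _ _ xab yb1 (sub_rect (lexx _) (lexx _) yab (lexx _) hc3)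
    (sub_rect (lexx _) (lexx _) yab (lexx _) hd3)).
  by move=> x y _ hy; apply: neIm; lra.
rewrite !(add0r, addr0).
have hc4 := sub_rect (lexx xa) (lexx xb) (lexx ya) yb1 hc3.
apply: le_trans (rint_bound (M := cabs (G e) + 1) xab yab (in_rect_bd xab yab hc4) _) _.
- apply: (in_rect_bd xab yab) => x y hx hy.
  have eE : e = pt (Re e) (Im e) by case: (e).
  have hh : cabs (G (pt x y) - G e) <= 1.
    apply: ltW; apply: hd1; rewrite [in ltLHS]eE.
    apply: le_lt_trans (cabs_pt_le _ _ _ _) _.
    have : `|x - Re e| <= s by rewrite ler_norml; lra.
    have : `|y - Im e| <= s by rewrite ler_norml; lra.
    lra.
  have -> : G (pt x y) = G e + (G (pt x y) - G e) by ring.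
  by rewrite (le_trans (cabsD _ _)) // lerD2l.
- have G0 := cabs_ge0 (G e).
  have : (cabs (G e) + 1) * (xb - xa + (yb - ya)) <= (cabs (G e) + 1) * (4 * s).
    by rewrite ler_wpM2l; lra.
  lra.
Qed.

End Cauchy.

(** * Cauchy's formula *)

Section CauchyFormula.
Context {R : realType}.
Local Notation C := (Cplx R).
Implicit Types (F G : C -> C) (a b x y : R) (c l : C) (P : C -> Prop).

Lemma on_bdW (P Q : C -> Prop) (x0 x1 y0 y1 : R) : (forall z, P z -> Q z) ->
  on_bd P x0 x1 y0 y1 -> on_bd Q x0 x1 y0 y1.
Proof.
move=> PQ [h1 h2]; split=> t ht.
  by have [p q] := h1 t ht; split; exact: PQ.
by have [p q] := h2 t ht; split; exact: PQ.
Qed.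

Lemma on_bd_and (P Q : C -> Prop) (x0 x1 y0 y1 : R) :
  on_bd P x0 x1 y0 y1 -> on_bd Q x0 x1 y0 y1 -> on_bd (fun z => P z /\ Q z) x0 x1 y0 y1.
Proof.
move=> [h1 h2] [h3 h4]; split=> t ht.
  by case: (h1 t ht) (h3 t ht) => a b [c d]; split; split.
by case: (h2 t ht) (h4 t ht) => a b [c d]; split; split.
Qed.

Lemma cts_cst c z : cts (fun=> c) z.
Proof. exact: cst_continuous. Qed.
Lemma cts_id z : cts (fun w : C => w) z.
Proof. exact: cvg_id. Qed.
Lemma ctsD F G z : cts F z -> cts G z -> cts (fun w => F w + G w) z.
Proof. exact: continuousD. Qed.
Lemma ctsB F G z : cts F z -> cts G z -> cts (fun w => F w - G w) z.
Proof. exact: continuousB. Qed.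
Lemma ctsM F G z : cts F z -> cts G z -> cts (fun w => F w * G w) z.
Proof. exact: continuousM. Qed.
Lemma ctsV F z : F z != 0 -> cts F z -> cts (fun w => (F w)^-1) z.
Proof. by move=> F0 hF; exact: (cvgV F0 hF). Qed.
Lemma cts_Cdiv F G z : G z != 0 -> cts F z -> cts G z -> cts (fun w => F w / G w) z.
Proof. by move=> G0 hF hG; apply: ctsM hF (ctsV G0 hG). Qed.
Lemma near_cts F G z : (\forall w \near z, F w = G w) -> cts F z -> cts G z.
Proof.
move=> h Fz; have e : F z = G z := nbhs_singleton h.
rewrite /cts /prop_for /continuous_at -e; apply: cvg_trans Fz.
exact: (@near_eq_cvg _ _ (nbhs z) (nbhs_filter z) _ _ h).
Qed.

Lemma derivableCM F G z : derivable F z 1 -> derivable G z 1 ->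
  derivable (fun w => F w * G w) z 1.
Proof. exact: derivableM. Qed.
Lemma derivableCV F z : F z != 0 -> derivable F z 1 -> derivable (fun w => (F w)^-1) z 1.
Proof. exact: derivableV. Qed.
Lemma derivable_subC c z : derivable (fun w : C => w - c) z 1.
Proof. by apply: derivableB; [exact: derivable_id|exact: derivable_cst]. Qed.

Lemma cts_on_bounded (phi : R -> C) a b : cts_on phi a b ->
  exists M, forall x, a <= x <= b -> cabs (phi x) <= M.
Proof.
move=> h; have [ab|ba] := leP a b; last by exists 0 => x xab; lra.
have hc : {within `[a, b], continuous (fun x => cabs (phi x))}.
  apply: continuous_in_subspaceT => x /set_mem /=; rewrite in_itv /= => xab.
  apply: (@continuous_comp _ _ _ (fun x => `|phi x|) (fun z : C => Re z)).
    apply: (@continuous_comp _ _ _ phi (fun z : C => `|z|)); first exact: h.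
    exact: norm_continuous.
  exact: continuousRe.
have [m _ hm] := EVT_max ab hc.
by exists (cabs (phi m)) => x xab; apply: hm; rewrite in_itv.
Qed.

Lemma on_bd_bounded G (x0 x1 y0 y1 : R) : on_bd (cts G) x0 x1 y0 y1 ->
  exists2 M, 0 <= M & on_bd (fun z => cabs (G z) <= M) x0 x1 y0 y1.
Proof.
case=> h1 h2.
have [M1 hM1] := cts_on_bounded (cts_onx (fun x hx => (h1 x hx).1)).
have [M2 hM2] := cts_on_bounded (cts_onx (fun x hx => (h1 x hx).2)).
have [M3 hM3] := cts_on_bounded (cts_ony (fun x hx => (h2 x hx).1)).
have [M4 hM4] := cts_on_bounded (cts_ony (fun x hx => (h2 x hx).2)).
exists (`|M1| + `|M2| + `|M3| + `|M4|); first by rewrite !addr_ge0.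
have := ler_norm M1; have := ler_norm M2; have := ler_norm M3; have := ler_norm M4.
have := normr_ge0 M1; have := normr_ge0 M2; have := normr_ge0 M3; have := normr_ge0 M4.
move: (`|M1|) (`|M2|) (`|M3|) (`|M4|) => m1 m2 m3 m4 p1 p2 p3 p4 q1 q2 q3 q4.
split=> t ht; split.
- by apply: le_trans (hM1 t ht) _; clear -p1 p2 p3 p4 q1 q2 q3 q4; lra.
- by apply: le_trans (hM2 t ht) _; clear -p1 p2 p3 p4 q1 q2 q3 q4; lra.
- by apply: le_trans (hM3 t ht) _; clear -p1 p2 p3 p4 q1 q2 q3 q4; lra.
- by apply: le_trans (hM4 t ht) _; clear -p1 p2 p3 p4 q1 q2 q3 q4; lra.
Qed.

Variables (t0 : C) (rho : R).
Hypothesis rho0 : 0 < rho.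

Local Notation bd P := (on_bd P (Re t0 - rho) (Re t0 + rho) (Im t0 - rho) (Im t0 + rho)).
Local Notation sq P := (in_rect P (Re t0 - rho) (Re t0 + rho) (Im t0 - rho) (Im t0 + rho)).
Local Notation oint G := (rint G (Re t0 - rho) (Re t0 + rho) (Im t0 - rho) (Im t0 + rho)).

Let xle : Re t0 - rho <= Re t0 + rho. Proof. by have := rho0; lra. Qed.
Let yle : Im t0 - rho <= Im t0 + rho. Proof. by have := rho0; lra. Qed.

Lemma bd_far : bd (fun z => rho <= cabs (z - t0)).
Proof.
split=> t ht; split.
- apply: le_trans (Im_le_cabs _); rewrite !ReImE /= (_ : _ - _ = - rho); last by lra.
  by rewrite normrN ler_norm.
- apply: le_trans (Im_le_cabs _); rewrite !ReImE /= (_ : _ - _ = rho); last by lra.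
  by rewrite ler_norm.
- apply: le_trans (Re_le_cabs _); rewrite !ReImE /= (_ : _ - _ = - rho); last by lra.
  by rewrite normrN ler_norm.
- apply: le_trans (Re_le_cabs _); rewrite !ReImE /= (_ : _ - _ = rho); last by lra.
  by rewrite ler_norm.
Qed.

Lemma sq_near : sq (fun z => cabs (z - t0) <= 2 * rho).
Proof.
move=> x y hx hy; apply: le_trans (cabs_le_ReIm _) _; rewrite !ReImE /=.
have : `|x - Re t0| <= rho by rewrite ler_norml; lra.
have : `|y - Im t0| <= rho by rewrite ler_norml; lra.
lra.
Qed.

Lemma far_half z w : cabs (z - t0) <= rho / 2 -> rho <= cabs (w - t0) ->
  rho / 2 <= cabs (w - z).
Proof.
move=> hz hw; have : cabs (w - t0) <= cabs (w - z) + cabs (z - t0).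
  by rewrite (le_trans _ (cabsD _ _)) // subrKA.
lra.
Qed.

Lemma far_neq z w : cabs (z - t0) <= rho / 2 -> rho <= cabs (w - t0) -> w - z != 0.
Proof.
move=> hz hw; rewrite -cabs_gt0 (lt_le_trans _ (far_half hz hw)) //.
by rewrite divr_gt0.
Qed.

Let near0 : cabs (t0 - t0) <= rho / 2.
Proof. by rewrite subrr cabs0 divr_ge0 // ltW. Qed.

(** The Cauchy integral without the factor [1 / (2 pi i)]; its normalisation is the same integral
    for [phi = 1]. *)
Definition cauchy_int phi z : C := oint (fun w => phi w / (w - z)).

Lemma cts_kernel phi z : cabs (z - t0) <= rho / 2 -> bd (cts phi) ->
  bd (cts (fun w => phi w / (w - z))).
Proof.
move=> hz hphi; apply: on_bdW (on_bd_and hphi bd_far) => w [hw1 hw2].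
apply: cts_Cdiv hw1 _; first exact: far_neq hw2.
exact: (ctsB (F := fun w => w) (G := fun=> z) (@cts_id w) (@cts_cst z w)).
Qed.

(** Expanding [1 / (w - z)] around [t0] to second order leaves the remainder
    [(z - t0)^2 / ((w - t0)^2 (w - z))]. On the boundary [cabs (w - t0) >= rho] and
    [cabs (w - z) >= rho / 2], so the error is at most [K * cabs (z - t0) ^+ 2]. Only continuity of
    [phi] on the boundary enters, which is why such integrals are differentiable before anything is
    known about [phi] inside. *)
Lemma is_derive_cauchy_int phi : bd (cts phi) ->
  is_derive t0 1 (cauchy_int phi) (oint (fun w => phi w / (w - t0) / (w - t0))).
Proof.
move=> hphi; have [M M0 hM] := on_bd_bounded hphi.
set D := oint _.
pose K := 4 * (M * (rho^-1 * rho^-1 * (rho / 2)^-1)) * (2 * rho + 2 * rho).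
have rV : 0 <= rho^-1 by rewrite invr_ge0 ltW.
have K0 : 0 <= K.
  by rewrite /K !mulr_ge0 ?addr_ge0 ?mulr_ge0 ?invr_ge0 ?divr_ge0 // ltW.
have quad z : cabs (z - t0) <= rho / 2 ->
    cabs (cauchy_int phi z - cauchy_int phi t0 - D * (z - t0)) <= K * cabs (z - t0) ^+ 2.
  move=> hz.
  pose H1 w := phi w / (w - t0).
  pose H2 w := phi w / (w - t0) / (w - t0).
  pose H3 w := phi w / (w - t0) / (w - t0) / (w - z).
  have c1 : bd (cts H1) by exact: cts_kernel.
  have c2 : bd (cts H2) by exact: cts_kernel.
  have c3 : bd (cts H3) by exact: cts_kernel.
  have cZ H k : bd (cts H) -> bd (cts (fun w => k * H w)).
    by apply: on_bdW => w hw; exact: (ctsM (F := fun=> k) (@cts_cst k w) hw).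
  have c12 : bd (cts (fun w => H1 w + (z - t0) * H2 w)).
    by apply: on_bdW (on_bd_and c1 (cZ _ (z - t0) c2)) => w [h1 h2]; exact: (ctsD h1 h2).
  have -> : cauchy_int phi z - cauchy_int phi t0 - D * (z - t0) = (z - t0) ^+ 2 * oint H3.
    have -> : cauchy_int phi z = oint H1 + (z - t0) * oint H2 + (z - t0) ^+ 2 * oint H3.
      rewrite -(rintZ _ c2) -(rintZ _ c3) -(rintD c1 (cZ _ _ c2)) -(rintD c12 (cZ _ _ c3)).
      apply: eq_rint; apply: on_bdW bd_far => w hw.
      have n1 := far_neq hz hw; have n2 := far_neq near0 hw.
      rewrite /H1 /H2 /H3; field; rewrite n1 n2 //.
    rewrite -/(cauchy_int phi t0) -/D; ring.
  rewrite cabsM cabsX mulrC ler_wpM2r ?exprn_ge0 ?cabs_ge0 //.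
  apply: le_trans (rint_bound (M := M * (rho^-1 * rho^-1 * (rho / 2)^-1)) xle yle c3 _) _.
    apply: on_bdW (on_bd_and hM bd_far) => w [h1 h2].
    have wh := far_half hz h2.
    have wn := far_neq hz h2; have wn0 := far_neq near0 h2.
    rewrite /H3 !cabsM !cabsV -!mulrA.
    have i1 : (cabs (w - t0))^-1 <= rho^-1 by rewrite lef_pV2 // posrE cabs_gt0.
    have i2 : (cabs (w - z))^-1 <= (rho / 2)^-1.
      by rewrite lef_pV2 // posrE ?cabs_gt0 // divr_gt0.
    by do !apply: ler_pM; rewrite ?mulr_ge0 ?invr_ge0 ?cabs_ge0.
  by rewrite le_eqVlt /K; apply/orP; left; apply/eqP; ring.
apply/is_deriveCP => e e0.
have K10 : 0 < K + 1 by rewrite ltr_wpDl.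
exists (Num.min (rho / 2) (e / (K + 1))).
  by rewrite lt_min !divr_gt0.
move=> z; rewrite lt_min => /andP[/ltW z1]; rewrite ltr_pdivlMr // => z2.
apply: le_trans (quad z z1) _; rewrite expr2 mulrA ler_wpM2r ?cabs_ge0 //.
have := cabs_ge0 (z - t0); nra.
Qed.

End CauchyFormula.

(** * Difference quotients, Cauchy's formula on a square, removable singularities *)

Section IsolatedZeros.
Context {R : realType}.
Local Notation C := (Cplx R).
Implicit Types (F G : C -> C) (a b x y : R) (c l : C) (P : C -> Prop).

Lemma ReV c : Re c^-1 = Re c / (Re c ^+ 2 + Im c ^+ 2).
Proof. by case: c. Qed.
Lemma ImV c : Im c^-1 = - Im c / (Re c ^+ 2 + Im c ^+ 2).
Proof. by case: c => a b; rewrite mulNr. Qed.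

Definition slope G z w : C := if w == z then 'D_1 G z else (G w - G z) / (w - z).

Lemma slopeE G z w : w != z -> slope G z w = (G w - G z) / (w - z).
Proof. by rewrite /slope => /negbTE ->. Qed.

Lemma near_slope G z w : w != z -> \forall v \near w, (G v - G z) / (v - z) = slope G z v.
Proof.
move=> wz; apply/nbhsCP; exists (cabs (w - z)); first by rewrite cabs_gt0 subr_eq0.
move=> v hv; rewrite slopeE //; apply: contraTneq hv => ->.
by rewrite cabs_distC ltxx.
Qed.

Lemma cts_slope G z w : derivable G z 1 -> cts G w -> cts (slope G z) w.
Proof.
move=> dz Gw; have [->|wz] := eqVneq w z; last first.
  apply: near_cts (near_slope G wz) _; apply: cts_Cdiv; first by rewrite subr_eq0.
    exact: (ctsB (F := G) (G := fun=> G z) Gw (@cts_cst _ _ _)).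
  exact: (ctsB (F := fun w => w) (G := fun=> z) (@cts_id _ _) (@cts_cst _ _ _)).
apply/continuousCP => e e0; have e20 : 0 < e / 2 by rewrite divr_gt0.
have [d d0 h] := (is_deriveCP _ _ _).1 (derivableP dz) _ e20.
exists d => // {Gw}w hw; have [->|wz] := eqVneq w z; first by rewrite subrr cabs0.
rewrite slopeE // {1}/slope eqxx; have wz0 : w - z != 0 by rewrite subr_eq0.
have -> : (G w - G z) / (w - z) - 'D_1 G z =
  (G w - G z - 'D_1 G z * (w - z)) / (w - z) by rewrite [RHS]mulrBl mulfK.
rewrite cabsM cabsV ltr_pdivrMr ?cabs_gt0 //; apply: le_lt_trans (h w hw) _.
by rewrite ltr_pM2r ?cabs_gt0 // ltr_pdivrMr // ltr_pMr // ltr1n.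
Qed.

Lemma derivable_slope G z w : w != z -> derivable G w 1 -> derivable (slope G z) w 1.
Proof.
move=> wz Gw; apply: near_eq_derivable (near_slope G wz) _; apply: derivableCM.
  by apply: derivableB; [exact: Gw|exact: derivable_cst].
by apply: derivableCV; [rewrite subr_eq0|exact: derivable_subC].
Qed.

Section Square.
Variables (t0 : C) (rho : R).
Hypothesis rho0 : 0 < rho.

Local Notation bd P := (on_bd P (Re t0 - rho) (Re t0 + rho) (Im t0 - rho) (Im t0 + rho)).
Local Notation sq P := (in_rect P (Re t0 - rho) (Re t0 + rho) (Im t0 - rho) (Im t0 + rho)).
Local Notation oint G := (rint G (Re t0 - rho) (Re t0 + rho) (Im t0 - rho) (Im t0 + rho)).

Let xle : Re t0 - rho <= Re t0 + rho. Proof. by have := rho0; lra. Qed.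
Let yle : Im t0 - rho <= Im t0 + rho. Proof. by have := rho0; lra. Qed.

(** For [z] inside the square this is [2 pi i]. It stays a function of [z], to which
    [is_derive_cauchy_int] applies. *)
Definition winding := cauchy_int t0 rho (fun=> 1).

Lemma bd_cst1 : bd (cts (fun=> 1 : C)).
Proof. by split=> t ht; split; exact: cst_continuous. Qed.

(* The integrand of [oint dz / (z - t0)] on two opposite sides combines to
   [2 * i * rho / (s ^+ 2 + rho ^+ 2) >= i / rho]. *)
Lemma winding_neq0 : winding t0 != 0.
Proof.
have rn : rho != 0 by rewrite gt_eqF.
have low (s : R) : `|s| <= rho -> 1 / rho <= 2 * rho / (s ^+ 2 + rho ^+ 2).
  move=> hs; have s2 : s ^+ 2 <= rho ^+ 2.
    by move: hs; rewrite ler_norml => /andP[h1 h2]; have := rho0; nra.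
  have p : 0 < s ^+ 2 + rho ^+ 2 by rewrite ltr_wpDl ?sqr_ge0 ?exprn_gt0.
  rewrite ler_pdivlMr // mulrAC ler_pdivrMr // mul1r -mulrA -expr2; lra.
have sides : 0 < Im (winding t0).
  have cw : bd (cts (fun w => 1 / (w - t0))).
    apply: (cts_kernel rho0 _ bd_cst1); by rewrite subrr cabs0 divr_ge0 // ltW.
  (* A pair of opposite sides contributes the integral, over an interval of length [2 * rho], of a
     function that is at least [1 / rho]. *)
  have half (phi : R -> C) (f : C -> R) u : continuous (f : C -> R^o) ->
      cts_on phi (u - rho) (u + rho) ->
      (forall x, `|x - u| <= rho -> 1 / rho <= f (phi x)) ->
      1 <= \int[lebesgue_measure]_(x in `[u - rho, u + rho]) f (phi x).
    move=> fc hphi hlow.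
    apply: (@le_trans _ _ (1 / rho * (u + rho - (u - rho)))).
      have -> : 1 / rho * (u + rho - (u - rho)) = 2 by field.
      by rewrite ler1n.
    have ule : u - rho <= u + rho by have := rho0; lra.
    rewrite -Rintegral_itv_cst //; apply: le_Rintegral => //.
    - by apply: cts_on_integrable => x _; exact: cst_continuous.
    - apply: cts_on_integrable => x hx; apply: continuous_comp; first exact: hphi.
      exact: fc.
    - by move=> x /=; rewrite in_itv /= => hx; apply: hlow; rewrite ler_norml; lra.
  rewrite /winding /cauchy_int /rint !ReImE /= mul0r mul1r add0r.
  apply: (@lt_le_trans _ _ (1 + 1)); first by rewrite addr_gt0.
  apply: lerD.
    apply: (half _ (fun z => Im z)); [exact: continuousIm|exact: (bd_cts_onx cw)|].
    move=> x /low h; apply: le_trans h _; rewrite le_eqVlt; apply/orP; left; apply/eqP.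
    rewrite !mul1r !ReImE /= !ImV !ReImE /=.
    have -> : Im t0 - rho - Im t0 = - rho by ring.
    have -> : Im t0 + rho - Im t0 = rho by ring.
    by rewrite sqrrN -mulrBl; congr (_ / _); ring.
  apply: (half _ (fun z => Re z)); [exact: continuousRe|exact: (bd_cts_ony cw)|].
  move=> x /low h; apply: le_trans h _; rewrite le_eqVlt; apply/orP; left; apply/eqP.
  rewrite !mul1r !ReImE /= !ReV !ReImE /=.
  have -> : Re t0 - rho - Re t0 = - rho by ring.
  have -> : Re t0 + rho - Re t0 = rho by ring.
  by rewrite sqrrN -mulrBl; congr (_ / _); ring.
by apply: contraTneq sides => ->; rewrite ltxx.
Qed.

(** Goursat's theorem for [slope G z], with [z] added to the exceptional points, says that the
    integral of [(G w - G z) / (w - z)] vanishes; splitting the numerator gives the formula. *)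
Lemma cauchy_formula (E : seq C) G z : cabs (z - t0) <= rho / 2 ->
  sq (cts G) -> sq (fun w => w \notin E -> derivable G w 1) -> derivable G z 1 ->
  G z * winding z = cauchy_int t0 rho G z.
Proof.
move=> hz hc hd dz.
have kc : sq (cts (slope G z)).
  by move=> x y hx hy; exact: cts_slope dz (hc x y hx hy).
have kd : sq (fun w => w \notin z :: E -> derivable (slope G z) w 1).
  move=> x y hx hy; rewrite inE negb_or => /andP[wz wE].
  exact: derivable_slope wz (hd x y hx hy wE).
have := goursat_except xle yle kc kd.
have c1 := cts_kernel rho0 hz (in_rect_bd xle yle hc).
have c2 := cts_kernel rho0 hz bd_cst1.
have c2' : bd (cts (fun w => - G z * (1 / (w - z)))).
  by apply: on_bdW c2 => w hw; exact: (ctsM (F := fun=> - G z) (@cts_cst _ _ _) hw).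
have -> : oint (slope G z) = oint (fun w => G w / (w - z) + - G z * (1 / (w - z))).
  apply: eq_rint; apply: on_bdW (bd_far t0 rho) => w hw.
  have wz := far_neq rho0 hz hw.
  have wz1 : w != z by rewrite -subr_eq0.
  rewrite (slopeE G wz1) mul1r mulNr -mulrBl; reflexivity.
rewrite (rintD c1 c2') (rintZ _ c2) => /eqP; rewrite mulNr subr_eq0 => /eqP e.
exact: esym e.
Qed.

End Square.

(** Off [t0], Cauchy's formula writes [G] as the quotient of [cauchy_int] by [winding], and this
    quotient is differentiable at [t0]. At [t0] itself the formula would presuppose
    differentiability, so there the equality follows from the continuity of both sides. *)
Lemma removable_singularity G t0 (r : R) : 0 < r -> cts G t0 ->
  (forall z, cabs (z - t0) < r -> z != t0 -> derivable G z 1) -> derivable G t0 1.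
Proof.
move=> r0 ct0 hd.
(* The square reaches out to distance at most [2 * rho < r] from [t0]. *)
pose rho := r / 4; have rho0 : 0 < rho by rewrite divr_gt0.
have rhor : 2 * rho < r by rewrite /rho; lra.
have hc : in_rect (cts G) (Re t0 - rho) (Re t0 + rho) (Im t0 - rho) (Im t0 + rho).
  move=> x y hx hy; have [->|wz] := eqVneq (pt x y) t0; first exact: ct0.
  apply: derivable_continuous; apply: hd => //.
  exact: le_lt_trans (sq_near hx hy) rhor.
have hd' : in_rect (fun w => w \notin [:: t0] -> derivable G w 1)
    (Re t0 - rho) (Re t0 + rho) (Im t0 - rho) (Im t0 + rho).
  move=> x y hx hy; rewrite inE => wz; apply: hd => //.
  exact: le_lt_trans (sq_near hx hy) rhor.
have bdc := in_rect_bd _ _ hc.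
have {}bdc : on_bd (cts G) (Re t0 - rho) (Re t0 + rho) (Im t0 - rho) (Im t0 + rho).
  by apply: bdc; clear -rho0; lra.
have [dN _] := is_derive_cauchy_int rho0 bdc.
have [dc _] := is_derive_cauchy_int rho0 (bd_cst1 t0 rho).
have w0 := winding_neq0 t0 rho0.
have dq : derivable (fun z => cauchy_int t0 rho G z * (winding t0 rho z)^-1) t0 1.
  by apply: derivableCM dN (derivableCV _ dc).
have [d d0 hw] := (continuousCP _ _).1 (derivable_continuous dc) _
  (etrans (cabs_gt0 _) w0).
have wn z : cabs (z - t0) < d -> winding t0 rho z != 0.
  move=> /hw; apply: contraTneq; rewrite /winding => ->.
  by rewrite sub0r cabsN ltxx.
have eqp z : cabs (z - t0) < Num.min d (rho / 2) -> z != t0 ->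
    cauchy_int t0 rho G z * (winding t0 rho z)^-1 = G z.
  rewrite lt_min => /andP[zd zr] zt0.
  have zr' : cabs (z - t0) < r by apply: lt_trans zr _; rewrite /rho; clear -r0; lra.
  rewrite -(cauchy_formula rho0 (ltW zr) hc hd' (hd z zr' zt0)) mulfK //.
  exact: wn.
have m0 : 0 < Num.min d (rho / 2) by rewrite lt_min d0 divr_gt0.
apply: near_eq_derivable (dq); apply/nbhsCP; exists (Num.min d (rho / 2)) => // z hz.
have [->|zt0] := eqVneq z t0; last exact: eqp.
set q := fun z => cauchy_int t0 rho G z * (winding t0 rho z)^-1.
have cq : cts q t0 := derivable_continuous dq.
apply/eqP; rewrite -subr_eq0 -cabs_eq0 eq_le cabs_ge0 andbT.
apply: (le0_small (K := 2) ltr01) => e /andP[e0 _].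
have [d1 d10 h1] := (continuousCP _ _).1 cq e e0.
have [d2 d20 h2] := (continuousCP _ _).1 ct0 e e0.
(* [v] is a point other than [t0], so near that [q] and [G] each differ by less than [e] from their
   values at [t0], while [q v = G v]. *)
pose m := Num.min (Num.min d (rho / 2)) (Num.min d1 d2).
have mm0 : 0 < m by rewrite !lt_min d0 d10 d20 divr_gt0.
pose v : C := t0 + RtoC (m / 2).
have vt : cabs (v - t0) = m / 2.
  by rewrite /v addrAC subrr add0r cabs_RtoC ger0_norm // divr_ge0 // ltW.
have vm : cabs (v - t0) < m by rewrite vt; clear -mm0; lra.
have vt0 : v != t0 by rewrite -subr_eq0 -cabs_eq0 vt gt_eqF // divr_gt0.
move: vm; rewrite lt_min => /andP[vm1]; rewrite lt_min => /andP[vm2 vm3].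
have {}h1 := h1 v vm2; have {}h2 := h2 v vm3.
have -> : q t0 - G t0 = (G v - G t0) - (q v - q t0).
  by rewrite {2}/q (eqp v vm1 vt0); ring.
apply: le_trans (cabsB _ _) _; rewrite mulr2n mulrDr mulr1 lerD // ltW //.
Qed.

End IsolatedZeros.

(** * The identity theorem *)

Section IdentityTheorem.
Context {R : realType}.
Local Notation C := (Cplx R).
Implicit Types (F G f : C -> C) (a b x y : R) (c l t : C) (P : C -> Prop).

(** [F] is the difference quotient at [t0]: continuous there, hence differentiable by
    [removable_singularity]. The factorisation holds for all [z], so the lemma can be iterated on
    the same disc. *)
Lemma factor_zero G t0 (r : R) : 0 < r ->
  (forall z, cabs (z - t0) < r -> derivable G z 1) -> G t0 = 0 ->
  exists2 F, (forall z, cabs (z - t0) < r -> derivable F z 1)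
    & forall z, G z = (z - t0) * F z.
Proof.
move=> r0 hd G0; have d0 : derivable G t0 1 by apply: hd; rewrite subrr cabs0.
exists (slope G t0) => z.
  have [-> _|zt hz] := eqVneq z t0; last exact: derivable_slope zt (hd z hz).
  apply: (removable_singularity r0).
    exact: cts_slope d0 (derivable_continuous d0).
  by move=> w hw wt; exact: derivable_slope wt (hd w hw).
have [->|zt] := eqVneq z t0; first by rewrite subrr mul0r.
by rewrite slopeE // G0 subr0 mulrC mulfVK // subr_eq0.
Qed.

(* [G = (z - t0)^m F] with [F] holomorphic gives [|F| <= K sup |G| / rho^m] near
   [t0] by Cauchy's formula; for all [m] at once this forces [G = 0]. *)
Lemma isolated_zeros G t0 : (\forall t \near t0, derivable G t 1) ->
  (\forall t \near t0, G t = 0) \/ (\forall t \near t0^', G t != 0).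
Proof.
move=> /nbhsCP[r r0 hd].
have [|nz] := pselect (\forall t \near t0^', G t != 0); [by right|left].
(* If some quotient [F] were nonzero at [t0], it would be nonzero nearby and [G] nonzero off [t0],
   against [nz]. Hence division by [z - t0] never stops. *)
have fac m : exists2 F, (forall z, cabs (z - t0) < r -> derivable F z 1)
    & forall z, G z = (z - t0) ^+ m * F z.
  elim: m => [|m [F hF GF]]; first by exists G => // z; rewrite expr0 mul1r.
  have [F0|F0] := eqVneq (F t0) 0.
    have [F1 hF1 FF1] := factor_zero r0 hF F0.
    by exists F1 => // z; rewrite GF FF1 mulrA -exprSr.
  have dF : derivable F t0 1 by apply: hF; rewrite subrr cabs0.
  have F0' : 0 < cabs (F t0) by rewrite cabs_gt0.
  have [d d0 hd1] := (continuousCP _ _).1 (derivable_continuous dF) _ F0'.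
  exfalso; apply: nz; apply/dnbhsCP; exists d => // w hw wt.
  rewrite GF mulf_neq0 ?expf_neq0 ?subr_eq0 //.
  by apply: contraTneq (hd1 w hw) => ->; rewrite sub0r cabsN ltxx.
pose rho := r / 4; have rho0 : 0 < rho by rewrite divr_gt0.
have rhor : 2 * rho < r by rewrite /rho; clear -r0; lra.
have rhor2 : rho / 2 < r by clear -rhor rho0; lra.
have xle : Re t0 - rho <= Re t0 + rho by clear -rho0; lra.
have yle : Im t0 - rho <= Im t0 + rho by clear -rho0; lra.
have sqd F : (forall z, cabs (z - t0) < r -> derivable F z 1) ->
    in_rect (fun w => w \notin [::] -> derivable F w 1)
      (Re t0 - rho) (Re t0 + rho) (Im t0 - rho) (Im t0 + rho).
  by move=> h x y hx hy _; apply: h; exact: le_lt_trans (sq_near hx hy) rhor.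
have sqc F : (forall z, cabs (z - t0) < r -> derivable F z 1) ->
    in_rect (cts F) (Re t0 - rho) (Re t0 + rho) (Im t0 - rho) (Im t0 + rho).
  move=> h x y hx hy; apply: derivable_continuous; apply: h.
  exact: le_lt_trans (sq_near hx hy) rhor.
have [M M0 hM] := on_bd_bounded (in_rect_bd xle yle (sqc G hd)).
have [dw _] := is_derive_cauchy_int rho0 (bd_cst1 t0 rho).
pose w0 := cabs (winding t0 rho t0).
have w00 : 0 < w0 by rewrite cabs_gt0 winding_neq0.
have w02 : 0 < w0 / 2 by rewrite divr_gt0.
have [d d0 hw] := (continuousCP _ _).1 (derivable_continuous dw) _ w02.
apply/nbhsCP; exists (Num.min d (rho / 2)); first by rewrite lt_min d0 divr_gt0.
move=> z; rewrite lt_min => /andP[zd /ltW zrho].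
have wz : w0 / 2 <= cabs (winding t0 rho z).
  have : w0 <= cabs (winding t0 rho z) + cabs (winding t0 rho z - winding t0 rho t0).
    rewrite /w0 -[X in cabs X](subrKC (winding t0 rho z)).
    by rewrite [cabs (_ - _)]cabs_distC (le_trans (cabsD _ _)).
  have := ltW (hw z zd); rewrite -/(winding t0 rho); lra.
pose K := 4 * (M / (rho / 2)) * (4 * rho) / (w0 / 2).
(* On the boundary [cabs (w - t0) >= rho], whereas [cabs (z - t0) <= rho / 2]: each power of
   [z - t0] gains a factor 1/2. *)
have bound m : cabs (G z) <= 2^-1 ^+ m * K.
  have [F hF GF] := fac m.
  have zr : cabs (z - t0) < r by exact: le_lt_trans zrho rhor2.
  have cF := in_rect_bd xle yle (sqc F hF).
  have := cauchy_formula rho0 zrho (sqc F hF) (sqd F hF) (hF z zr).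
  have := rint_bound xle yle (cts_kernel rho0 zrho cF)
    (M := M / rho ^+ m / (rho / 2)).
  have bF : on_bd (fun w => cabs (F w / (w - z)) <= M / rho ^+ m / (rho / 2))
      (Re t0 - rho) (Re t0 + rho) (Im t0 - rho) (Im t0 + rho).
    apply: on_bdW (on_bd_and hM (bd_far t0 rho)) => w [h1 h2].
    rewrite cabsM cabsV; apply: ler_pM; rewrite ?invr_ge0 ?cabs_ge0 //.
      rewrite ler_pdivlMr ?exprn_gt0 // mulrC; apply: le_trans h1.
      rewrite GF cabsM cabsX ler_wpM2r ?cabs_ge0 //.
      by apply: lerXn2r; rewrite // nnegrE ?cabs_ge0 // ltW.
    have h3 := far_half zrho h2.
    rewrite lef_pV2 // posrE; first by rewrite (lt_le_trans _ h3) // divr_gt0.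
    by rewrite divr_gt0.
  move=> /(_ bF) hb eF; move: hb; rewrite -/(cauchy_int t0 rho F z) -eF cabsM => hb.
  have Fz : cabs (F z) <= 4 * (M / rho ^+ m / (rho / 2)) * (4 * rho) / (w0 / 2).
    rewrite ler_pdivlMr //; apply: le_trans (ler_wpM2l (cabs_ge0 _) wz) _.
    apply: le_trans hb _; rewrite le_eqVlt; apply/orP; left; apply/eqP.
    by congr (_ * _); ring.
  rewrite GF cabsM cabsX.
  have h4 : cabs (z - t0) ^+ m <= (rho / 2) ^+ m.
    by apply: lerXn2r; rewrite // nnegrE ?cabs_ge0 // divr_ge0 // ltW.
  apply: le_trans (ler_pM _ _ h4 Fz) _; rewrite ?exprn_ge0 ?cabs_ge0 //.
  rewrite le_eqVlt; apply/orP; left; apply/eqP; rewrite /K exprMn.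
  have rm : rho ^+ m != 0 by rewrite expf_neq0 // gt_eqF.
  have rn : rho != 0 by rewrite gt_eqF.
  have wn : w0 != 0 by rewrite gt_eqF.
  move: (rho ^+ m) (2^-1 ^+ m) rm => A B A0; field; rewrite A0 rn wn //.
apply/eqP; rewrite -cabs_eq0 eq_le cabs_ge0 andbT.
have lim0 : 2^-1 ^+ m * K @[m --> \oo] --> 0.
  rewrite -[0](mul0r K); apply: cvgMr_tmp.
  by apply: cvg_expr; rewrite ger0_norm ?invr_ge0 // invf_lt1 // ltr1n.
rewrite -(cvg_lim (@Rhausdorff R) lim0); apply: limr_ge; first by apply/cvg_ex; exists 0.
by apply: nearW => m; exact: bound.
Qed.

Lemma near_dnbhs_nbhs P t0 : (\forall t \near t0^', P t) ->
  \forall w \near t0^', \forall t \near w, P t.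
Proof.
move=> /dnbhsCP[e e0 h]; apply/dnbhsCP; exists e => // w hw wt0; apply/nbhsCP.
exists (Num.min (e - cabs (w - t0)) (cabs (w - t0))).
  by rewrite lt_min subr_gt0 hw cabs_gt0 subr_eq0.
move=> v; rewrite lt_min => /andP[h1 h2]; apply: h.
  have -> : v - t0 = (v - w) + (w - t0) by ring.
  rewrite (le_lt_trans (cabsD _ _)) //; lra.
by apply: contraTneq h2 => ->; rewrite cabs_distC ltxx.
Qed.

(** Lets a property of the punctured neighbourhoods of one point pass to all nearby points, as the
    propagation along a segment requires. *)
Lemma near_dnbhs P t0 : (\forall t \near t0^', P t) ->
  \forall w \near t0, \forall t \near w^', P t.
Proof.
move=> h; have /dnbhsCP[e e0 he] := near_dnbhs_nbhs h.
apply/nbhsCP; exists e; [exact: e0|move=> w hw].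
have [->|wt0] := eqVneq w t0; first exact: h.
have h2 := he w hw wt0; apply/dnbhsCP; have /nbhsCP[d d0 hd] := h2.
by exists d; [exact: d0|move=> v hv _; exact: hd].
Qed.

Lemma meromorphic_at_dichotomy f t0 : meromorphic_at f t0 ->
  (\forall t \near t0^', f t = 0) \/ (\forall t \near t0^', f t != 0).
Proof.
move=> [n [g [gd fg]]]; have [g0|g0] := isolated_zeros gd.
  left; near=> t; have -> : f t = (t - t0) ^- n * g t by near: t.
  have -> : g t = 0 by near: t; apply: cvg_within g0.
  by rewrite mulr0.
right; near=> t; have -> : f t = (t - t0) ^- n * g t by near: t.
rewrite mulf_neq0 ?invr_eq0 ?expf_neq0 ?subr_eq0 //.
  by near: t; apply/dnbhsCP; exists 1.
by near: t.
Unshelve. all: by end_near. Qed.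

Lemma derivableCX F n t : derivable F t 1 -> derivable (fun w => F w ^+ n) t 1.
Proof.
move=> dF; elim: n => [|n IH].
  rewrite (_ : (fun _ => _) = fun=> 1); first exact: derivable_cst.
  by apply/funext => w; rewrite expr0.
rewrite (_ : (fun _ => _) = fun w => F w * F w ^+ n); first exact: derivableCM.
by apply/funext => w; rewrite exprS.
Qed.

Lemma meromorphic_at_derivable f t0 : meromorphic_at f t0 ->
  \forall t \near t0^', derivable f t 1.
Proof.
move=> [n [g [gd /near_dnbhs_nbhs fg]]]; near=> t.
have tt0 : t - t0 != 0 by rewrite subr_eq0; near: t; apply/dnbhsCP; exists 1.
have ft : \forall w \near t, f w = (w - t0) ^- n * g w by near: t.
have gt : derivable g t 1 by near: t; apply: cvg_within gd.
apply: (@near_eq_derivable _ _ _ (fun w => ((w - t0) ^+ n)^-1 * g w)).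
  by apply: filterS ft => w ->.
apply: derivableCM gt; apply: derivableCV; first by rewrite expf_neq0.
exact/derivableCX/derivable_subC.
Unshelve. all: by end_near. Qed.

Lemma dnbhs_nonempty P t0 : (\forall t \near t0^', P t) -> exists t, P t.
Proof.
move=> /dnbhsCP[e e0 h]; exists (t0 + RtoC (e / 2)).
have e20 : 0 < e / 2 by rewrite divr_gt0.
have tE : t0 + RtoC (e / 2) - t0 = RtoC (e / 2) by rewrite addrAC subrr add0r.
apply: h; first by rewrite tE cabs_RtoC gtr0_norm //; lra.
by rewrite -subr_eq0 tE -cabs_eq0 cabs_RtoC gtr0_norm // gt_eqF.
Qed.

(** [phi] parametrises the segment from [t1] to [t0], which lies in the half-plane by convexity. [P]
    says that nonvanishing passes from the left end of a subinterval to its right end. Near [phi u],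
    either [f] vanishes identically, which contradicts nonvanishing at the left end, or it is
    nonzero around every nearby point. *)
Lemma meromorphic_nonzero f t1 : meromorphic f -> upper t1 ->
  (\forall t \near t1^', f t != 0) ->
  forall t0, upper t0 -> \forall t \near t0^', f t != 0.
Proof.
move=> mf u1 nz1 t0 u0.
pose phi s : C := t1 + RtoC s * (t0 - t1).
pose NZ t := \forall w \near t^', f w != 0.
pose P x (y s : R) := 0 <= x -> x + s <= 1 -> NZ (phi x) -> NZ (phi (x + s)).
have : P 0 0 1; last first.
  have phi0 : phi 0 = t1 by rewrite /phi (RtoC_nat 0) mul0r addr0.
  have phi1 : phi 1 = t0 by rewrite /phi (RtoC_nat 1) mul1r subrKC.
  rewrite /P add0r phi0 phi1 => h; exact: (h (lexx _) (lexx _) nz1).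
have Kn : 0 < cabs (t0 - t1) + 1 by rewrite ltr_wpDl ?cabs_ge0.
(* With [B = 0] this is bisection of the interval [[0, 1]]. *)
apply: (@rect_bisection _ P 1 0 0 0 ler01 (lexx _)).
  move=> x y s s0; rewrite /P mulr1 => P1 P2 _ _ x0 xs nzx.
  have xE : x + s = x + s / 2 + s / 2 by field.
  have x1 : x + s / 2 <= 1 by move: s0 xs; clear; lra.
  have x2 : 0 <= x + s / 2 by move: s0 x0; clear; lra.
  have x3 : x + s / 2 + s / 2 <= 1 by rewrite -xE.
  rewrite xE; exact: (P2 x2 x3 (P1 x0 x1 nzx)).
move=> u v; rewrite add0r => /andP[u00 u11] _.
have up : upper (phi u).
  rewrite /upper /phi !ReImE /= mul0r addr0 in u0 u1 *; nra.
have close (e : R) x s : 0 < s < e / (cabs (t0 - t1) + 1) -> x <= u <= x + s ->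
    cabs (phi x - phi u) < e /\ cabs (phi (x + s) - phi u) < e.
  move=> /andP[s0]; rewrite ltr_pdivlMr // => se hu.
  have dist w : `|w - u| <= s -> cabs (phi w - phi u) < e.
    move=> hw; have -> : phi w - phi u = RtoC (w - u) * (t0 - t1).
      by rewrite /phi RtoCD RtoCN; ring.
    rewrite cabsM cabs_RtoC; have := cabs_ge0 (t0 - t1); nra.
  by split; apply: dist; rewrite ler_norml; lra.
have [Z|nz] := meromorphic_at_dichotomy (mf _ up).
  have /nbhsCP[e e0 h] := near_dnbhs Z.
  exists (e / (cabs (t0 - t1) + 1)); first by rewrite divr_gt0.
  move=> x y s hs; rewrite mulr1 => hu _ _ _ nzx; exfalso.
  have hx := h _ (close e x s hs hu).1.
  have /dnbhs_nonempty[w] : \forall w \near (phi x)^', f w = 0 /\ f w != 0.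
    by near=> w; split; near: w.
  by move=> [->]; rewrite eqxx.
have /nbhsCP[e e0 h] := near_dnbhs nz.
exists (e / (cabs (t0 - t1) + 1)); first by rewrite divr_gt0.
by move=> x y s hs; rewrite mulr1 => hu _ _ _ _; apply: h; have [] := close e x s hs hu.
Unshelve. all: by end_near. Qed.

End IdentityTheorem.

(** * Divisor sums *)

Section Sigma.
Local Open Scope nat_scope.
Implicit Types (p r s m n d M : nat).

(* [divisors 0 = [:: 1]], so [sigma 0 = 1]. *)
Lemma sigma_leq n : 0 < n -> sigma n <= n * n.+1.
Proof.
case: n => [//|n] _.
rewrite /sigma (perm_big [seq d <- index_iota 0 n.+2 | d %| n.+1]); last first.
  apply: uniq_perm; rewrite ?divisors_uniq ?filter_uniq ?iota_uniq // => d.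
  rewrite mem_filter mem_index_iota -dvdn_divisors // ltnS /=.
  by case: (boolP (d %| n.+1)) => //= /dvdn_leq ->.
rewrite big_filter mulnC -[X in X * _](subn0 n.+2) -[leqRHS]sum_nat_const_nat.
rewrite big_mkcond; apply: leq_sum => d _; by case: ifP => // /dvdn_leq ->.
Qed.

Definition sigma_prime_to p n := \sum_(d <- divisors n | ~~ (p %| d)) d.

(** The divisors of [p * n] are the [p * d] with [d] dividing [n], and the divisors of [n] that [p]
    does not divide. *)
Lemma sigma_mul_prime p n : prime p -> 0 < n ->
  sigma (p * n) = p * sigma n + sigma_prime_to p n.
Proof.
move=> pp n0; have p0 := prime_gt0 pp.
transitivity (\sum_(d <- [seq p * d | d <- divisors n]
                 ++ [seq d <- divisors n | ~~ (p %| d)]) d); last first.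
  by rewrite big_cat /= big_map big_filter -big_distrr.
apply: perm_big; apply: uniq_perm.
- exact: divisors_uniq.
- rewrite cat_uniq map_inj_uniq ?divisors_uniq ?filter_uniq ?divisors_uniq ?andbT //.
    apply/hasPn => d; rewrite mem_filter => /andP[pd _]; apply/negP => /mapP[e _ de].
    by rewrite de dvdn_mulr in pd.
  by move=> a b /eqP; rewrite eqn_pmul2l // => /eqP.
move=> d; rewrite mem_cat mem_filter -!dvdn_divisors ?muln_gt0 ?p0 //.
have [pd|pd] /= := boolP (p %| d).
  rewrite orbF; have /dvdnP[e de] := pd; rewrite de [e * p]mulnC dvdn_pmul2l //.
  apply/idP/mapP => [en|[x xn /eqP]].
    by exists e => //; rewrite -dvdn_divisors.
  by rewrite eqn_pmul2l // => /eqP ->; rewrite -dvdn_divisors in xn.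
have -> : (d \in [seq p * i | i <- divisors n]) = false.
  by apply/negP => /mapP[e _ de]; rewrite de dvdn_mulr in pd.
by rewrite Gauss_dvdr // coprime_sym prime_coprime.
Qed.

Lemma sigma_prime_to_mul p n : prime p -> 0 < n ->
  sigma_prime_to p (p * n) = sigma_prime_to p n.
Proof.
move=> pp n0; rewrite /sigma_prime_to -[LHS]big_filter -[RHS]big_filter.
apply: perm_big; apply: uniq_perm; rewrite ?filter_uniq ?divisors_uniq // => d.
rewrite !mem_filter -!dvdn_divisors ?muln_gt0 ?(prime_gt0 pp) //.
have [|pd] //= := boolP (p %| d).
by rewrite Gauss_dvdr // coprime_sym prime_coprime.
Qed.

Lemma sigma_prime_to_id p n : ~~ (p %| n) -> 0 < n -> sigma_prime_to p n = sigma n.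
Proof.
move=> pn n0; rewrite /sigma_prime_to /sigma big_seq_cond [RHS]big_seq_cond.
apply: eq_bigl => d; rewrite andbT andb_idr // -dvdn_divisors // => dn.
by apply: contra pn => pd; exact: dvdn_trans dn.
Qed.

Definition geom p s := \sum_(i < s.+1) p ^ i.

Lemma geom0 p : geom p 0 = 1. Proof. by rewrite /geom big_ord1. Qed.

Lemma geomS p s : geom p s.+1 = 1 + p * geom p s.
Proof.
rewrite /geom big_ord_recl expn0 big_distrr /=; congr (_ + _).
by apply: eq_bigr => i _; rewrite -expnS.
Qed.

Lemma geomSr p s : geom p s.+1 = geom p s + p ^ s.+1.
Proof. by rewrite /geom big_ord_recr. Qed.

(** The divisors of [p ^ k * m] prime to [p] are those of [m], so [sigma_mul_prime] becomes the
    recursion [geomS], multiplied by [sigma m]. *)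
Lemma sigma_pfactor p s m : prime p -> ~~ (p %| m) -> 0 < m ->
  sigma (p ^ s * m) = geom p s * sigma m.
Proof.
move=> pp pm m0; have p0 := prime_gt0 pp.
have tau k : sigma_prime_to p (p ^ k * m) = sigma m.
  elim: k => [|k IH]; first by rewrite mul1n sigma_prime_to_id.
  by rewrite expnS -mulnA sigma_prime_to_mul // muln_gt0 expn_gt0 p0.
elim: s => [|s IH]; first by rewrite geom0 !mul1n.
rewrite expnS -mulnA sigma_mul_prime ?muln_gt0 ?expn_gt0 ?p0 // IH tau geomS; lia.
Qed.

Lemma geomD p a b : geom p (a + b).+1 = geom p a + p ^ a.+1 * geom p b.
Proof.
elim: b a => [|b IH] a; first by rewrite addn0 geomSr geom0 muln1.
by rewrite addnS -addSn IH geomSr [geom p b.+1]geomS !expnS; lia.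
Qed.

(** The product [sigma (p ^ r) * sigma (p ^ s)] for prime [p]. Lowering [r] and [s] together, the
    terms with [i > 0] are [p] times the previous identity, and the term [i = 0] is split by
    [geomD]. *)
Lemma geom_mul p r s :
  \sum_(i < r.+1 | i <= s) p ^ i * geom p ((r - i) + (s - i)) = geom p r * geom p s.
Proof.
elim: r s => [|r IH] [|s].
- by rewrite big_mkcond big_ord1 /= !subn0 geom0 muln1.
- by rewrite big_mkcond big_ord1 /= geom0 !mul1n.
- rewrite big_mkcond big_ord_recl /= big1 => [|i _]; last by [].
  by rewrite !subn0 !addn0 geom0 muln1 mul1n.
rewrite big_mkcond big_ord_recl /= !subn0 expn0 mul1n.
have -> : \sum_(i < r.+1) (if bump 0 i <= s.+1
    then p ^ bump 0 i * geom p (r.+1 - bump 0 i + (s.+1 - bump 0 i)) else 0)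
    = p * (geom p r * geom p s).
  rewrite -IH big_distrr [RHS]big_mkcond /=; apply: eq_bigr => i _.
  by rewrite /bump /= add1n ltnS !subSS expnS mulnA.
have -> : r.+1 + s.+1 = (s.+1 + r).+1 by lia.
rewrite geomD [geom p r.+1]geomS geomSr !expnS; ring.
Qed.

(** Written with exponent [r - i] so that the complementary divisor is [p ^ i], matching the
    summation index of [geom_mul]. *)
Lemma divisors_pexp p r : prime p ->
  perm_eq (divisors (p ^ r)) [seq p ^ (r - i) | i <- iota 0 r.+1].
Proof.
move=> pp; have p1 := prime_gt1 pp; apply: uniq_perm.
- exact: divisors_uniq.
- rewrite map_inj_in_uniq ?iota_uniq // => i j; rewrite !mem_iota !ltnS /= => ir jr /eqP.
  rewrite eqn_exp2l // => /eqP; lia.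
move=> d; rewrite -dvdn_divisors ?expn_gt0 ?(prime_gt0 pp) //.
apply/(dvdn_pfactor _ _ pp)/mapP => [[m mr ->]|[k]].
  by exists (r - m); rewrite ?mem_iota ?subKn // ltnS leq_subr.
by rewrite mem_iota => _ ->; exists (r - k); rewrite ?leq_subr.
Qed.

(** Compares the coefficients of [q^M] in the eigenvalue equation. Writing [M = p ^ s * m] with [m]
    prime to [p], a factor [sigma m] splits off and [geom_mul] remains. *)
Lemma sigma_hecke p r M : prime p -> 0 < M ->
  \sum_(d <- divisors (p ^ r) | p ^ r %/ d %| M)
     (p ^ r %/ d) * sigma (d * (M %/ (p ^ r %/ d))) = sigma (p ^ r) * sigma M.
Proof.
move=> pp M0; have p0 := prime_gt0 pp.
rewrite (perm_big _ (divisors_pexp r pp)) big_map -[iota 0 r.+1]/(index_iota 0 r.+1) big_mkord.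
have [m [s [pm ->]]] : exists m s, ~~ (p %| m) /\ M = p ^ s * m.
  have [m pm ->] := pfactor_coprime pp M0; exists m, (logn p M); split.
    by rewrite -prime_coprime.
  by rewrite mulnC.
have m0 : 0 < m by case: m pm => //; rewrite dvdn0.
rewrite -[p ^ r]muln1 !sigma_pfactor ?dvdn1 ?gtn_eqF ?prime_gt1 // muln1.
have -> : sigma 1 = 1 by rewrite /sigma big_seq1.
have quo i : i <= r -> p ^ r %/ p ^ (r - i) = p ^ i.
  by move=> ir; rewrite -{1}(subnK ir) expnD mulKn // expn_gt0 p0.
have dv i : (p ^ i %| p ^ s * m) = (i <= s).
  rewrite pfactor_dvdn ?muln_gt0 ?expn_gt0 ?p0 // lognM ?expn_gt0 ?p0 //.
  by rewrite pfactorK // lognE pp m0 (negbTE pm) addn0.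
rewrite muln1 mulnA -geom_mul big_distrl /=; apply: eq_big => i.
  have ir : i <= r by rewrite -ltnS.
  by rewrite (quo i ir) dv.
have ir : i <= r by rewrite -ltnS.
rewrite (quo i ir) dv => is_; rewrite -mulnA; congr (_ * _).
have -> : p ^ s * m %/ p ^ i = p ^ (s - i) * m.
  by rewrite -{1}(subnK is_) expnD -mulnA mulnCA mulKn // expn_gt0 p0.
by rewrite mulnA -expnD sigma_pfactor.
Qed.

End Sigma.

(** * Expansions in q *)

Section QSeries.
Context {R : realType}.
Local Notation C := (Cplx R).
Implicit Types (f : C -> C) (x y : R) (z w t : C) (u : nat -> C).

Lemma cexpD z w : cexp (z + w) = cexp z * cexp w :> C.
Proof.
apply: C_ext; rewrite /cexp !ReImE /= expRD ?cosD ?sinD; ring.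
Qed.

Lemma cexp0 : cexp 0 = 1 :> C.
Proof. by apply: C_ext; rewrite /cexp /= expR0 ?cos0 ?sin0 ?mulr1 ?mulr0. Qed.

Lemma cexpM_natl n z : cexp (n%:R * z) = cexp z ^+ n.
Proof.
elim: n => [|n IH]; first by rewrite mul0r cexp0 expr0.
by rewrite exprS -nat1r mulrDl mul1r cexpD IH.
Qed.

Lemma cabs_cexp z : cabs (cexp z) = expR (Re z).
Proof.
by rewrite /cabs normc_def /= !exprMn -mulrDr cos2Dsin2 mulr1 sqrtr_sqr ger0_norm //.
Qed.

Lemma cabs_qpow x t : cabs (qpow x t) = expR (- (2 * pi * x * Im t)).
Proof. by rewrite /qpow cabs_cexp !ReImE /=; congr expR; ring. Qed.

Lemma cexp_twopii : cexp twopii = 1 :> C.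
Proof.
apply: C_ext; rewrite /cexp /= expR0 mul1r mulr_natl ?cos2pi //; exact: sin2pi.
Qed.

Lemma cvgnCP u z : (u @ \oo --> z) <->
  forall e : R, 0 < e -> exists N, forall n, (N <= n)%N -> cabs (u n - z) < e.
Proof.
split=> [/cvgCP h e /h[N _ hN]|h]; first by exists N => n; exact: hN.
by apply/cvgCP => e /h[N hN]; exists N => // n; exact: hN.
Qed.

Lemma cvgn_series_bound u (v : nat -> R) : (forall n, cabs (u n) <= v n) ->
  cvgn (series v) -> cvgn (series u).
Proof.
move=> uv cv.
have v0 n : 0 <= v n by exact: le_trans (cabs_ge0 _) (uv n).
have cR (g : nat -> R) : (forall n, `|g n| <= cabs (u n)) -> cvgn (series g).
  move=> gu; apply: normed_cvg; apply: series_le_cvg cv => n.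
  - exact: normr_ge0.
  - exact: v0.
  - exact: le_trans (gu n) (uv n).
have [/cvg_ex[/= a ha] /cvg_ex[/= b hb]] :
    cvgn (series (fun n => Re (u n))) /\ cvgn (series (fun n => Im (u n))).
  by split; apply: cR => n; [exact: Re_le_cabs|exact: Im_le_cabs].
have sRe n : Re (series u n) = series (fun n => Re (u n)) n.
  rewrite /series /=; elim/big_ind2 : _ => // x1 x2 y1 y2 <- <-; exact: ReD.
have sIm n : Im (series u n) = series (fun n => Im (u n)) n.
  rewrite /series /=; elim/big_ind2 : _ => // x1 x2 y1 y2 <- <-; exact: ImD.
suff h : series u @ \oo --> ((a +i* b)%C : C) by exact: (cvgP _ h).
apply/cvgnCP => e e0.
have e20 : 0 < e / 2 by rewrite divr_gt0.
have [N1 _ h1] := (cvgrPdist_lt _ _).1 ha _ e20.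
have [N2 _ h2] := (cvgrPdist_lt _ _).1 hb _ e20.
exists (maxn N1 N2) => n; rewrite geq_max => /andP[n1 n2].
apply: le_lt_trans (cabs_le_ReIm _) _; rewrite !ReImE sRe sIm /=.
have := h1 n n1; have := h2 n n2; rewrite /= ![`|a - _|]distrC ![`|b - _|]distrC; lra.
Qed.

Lemma geometric_tail_le x n : 0 <= x <= 1 / 2 -> \sum_(0 <= i < n) x ^+ i.+1 <= 2 * x.
Proof.
move=> /andP[x0 x12].
(* The added term makes the induction work: [x^(n+1) + 2 x^(n+2) <= 2 x^(n+1)] as [x <= 1/2]. *)
have : \sum_(0 <= i < n) x ^+ i.+1 + 2 * x ^+ n.+1 <= 2 * x.
  elim: n => [|n IH]; first by rewrite big_nil add0r expr1.
  apply: le_trans IH; rewrite big_nat_recr //= -addrA lerD2l [x ^+ n.+2]exprS.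
  have : 0 <= x ^+ n.+1 by rewrite exprn_ge0.
  nra.
have : 0 <= 2 * x ^+ n.+1 by rewrite mulr_ge0 // exprn_ge0.
lra.
Qed.

(* At height [y] the term of index [n] is its value at a fixed [t1] times
   [E * x ^+ n] with [x] exponentially small in [y], so the leading term wins. *)
Lemma fourier_expansion_neq0 kappa (a : nat -> C) f : a 0%N = 1 ->
  fourier_expansion 1 kappa a f ->
  exists Y : R, forall t0, upper t0 -> Y < Im t0 -> \forall t \near t0^', f t != 0.
Proof.
move=> a0 [Y hY].
pose term n t := a n * qpow ((kappa + n%:R) / 1%:R) t.
pose tt : C := (0 +i* (`|Y| + 1))%C.
have [t1 ht1] : exists t, series (fun n => term n t) @ \oo --> f t.
  have utt : upper tt by rewrite /upper /= ltr_wpDl.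
  apply: dnbhs_nonempty (hY tt _ utt).
  by rewrite /=; have := ler_norm Y; lra.
(* The terms of the convergent series at [t1] tend to 0, hence are bounded. *)
have [B B0 hB] : exists2 B, 0 <= B & forall n, cabs (term n t1) <= B.
  have : (fun n => term n t1) @ \oo --> 0.
    by apply: cvg_series_cvg_0; exact: cvgP ht1.
  move=> /cvgnCP /(_ _ ltr01)[N hN].
  exists (1 + \sum_(0 <= i < N) cabs (term i t1)).
    by rewrite addr_ge0 // sumr_ge0 // => i _; exact: cabs_ge0.
  move=> n; have [Nn|nN] := leqP N n.
    have := ltW (hN n Nn); rewrite subr0 => h; apply: le_trans h _.
    by rewrite lerDl sumr_ge0 // => i _; exact: cabs_ge0.
  rewrite (bigD1_seq n) ?mem_index_iota ?iota_uniq //=.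
  rewrite addrCA lerDl addr_ge0 // sumr_ge0 // => i _; exact: cabs_ge0.
pose y1 := Im t1; pose c0 := cabs (term 0%N t1).
have c00 : 0 < c0.
  rewrite /c0 /term a0 mul1r cabs_qpow; exact: expR_gt0.
(* For [x <= delta] the tail, at most [2 * x * E * B], is at most half of the leading term
   [E * c0]. *)
pose delta := Num.min (1 / 2) (c0 / (4 * (B + 1))).
have B10 : 0 < 4 * (B + 1) by lra.
have delta0 : 0 < delta by rewrite lt_min !divr_gt0.
(* Once [s >= 1 / delta], the inequality [exp (2 pi s) >= 1 + 2 pi s] gives [x <= delta]. *)
exists (Num.max Y (y1 + 1 / delta)) => t0 ut0; rewrite gt_max => /andP[Yt0 yt0].
have /dnbhsCP[e1 e10 h1] := hY t0 Yt0 ut0.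
have e20 : 0 < Im t0 - (y1 + 1 / delta) by rewrite subr_gt0.
apply/dnbhsCP; exists (Num.min e1 (Im t0 - (y1 + 1 / delta))).
  by rewrite lt_min e10.
move=> t; rewrite lt_min => /andP[te1 te2] tt0; apply/eqP => ft0.
have := h1 t te1 tt0; rewrite ft0 => /cvgnCP cvt.
have dy : 1 / delta <= Im t - y1.
  have := Im_le_cabs (t - t0); rewrite !ReImE ler_norml => /andP[h _]; lra.
pose s := Im t - y1.
pose E := expR (- (2 * pi * kappa * s)).
have E0 : 0 < E by exact: expR_gt0.
pose x := expR (- (2 * pi * s)).
have d10 : 0 < 1 / delta by rewrite divr_gt0.
have xd : x <= delta.
  rewrite /x expRN -[delta]invrK lef_pV2 ?posrE ?expR_gt0 ?invr_gt0 //.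
  apply: le_trans (expR_ge1Dx _); rewrite -div1r.
  have := @pi_ge2 R; have : 1 / delta <= s by []. nra.
have x0 : 0 <= x by exact: expR_ge0.
have cterm n : cabs (term n t) = E * x ^+ n * cabs (term n t1).
  rewrite /term !cabsM !cabs_qpow [RHS]mulrCA /E /x -expRM_natl -!expRD.
  by congr (_ * expR _); rewrite /s /y1; field.
have x12 : 0 <= x <= 1 / 2 by rewrite x0 (le_trans xd) // ge_min lexx.
have xB : x * (4 * (B + 1)) <= c0.
  rewrite -ler_pdivlMr //; apply: le_trans xd _; by rewrite ge_min lexx orbT.
have [N hN] := cvt (E * c0 / 2) (divr_gt0 (mulr_gt0 E0 c00) (ltr0Sn _ _)).
have := hN N.+1 (leqnSn N); rewrite subr0 /series /= big_nat_recl //.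
rewrite -/(term 0%N t); set S := \sum_(0 <= i < N) _.
have hS : cabs S <= E * c0 / 2.
  apply: le_trans (cabs_sum _ _ _) _.
  apply: (@le_trans _ _ (\sum_(0 <= i < N) (E * B) * x ^+ i.+1)).
    apply: ler_sum => i _; rewrite -/(term i.+1 t) cterm [leRHS]mulrAC.
    by rewrite ler_wpM2l // mulr_ge0 ?exprn_ge0 // ltW.
  rewrite -big_distrr /=.
  apply: le_trans (ler_wpM2l _ (geometric_tail_le N x12)) _.
    by rewrite mulr_ge0 // ltW.
  have : 0 <= E * (c0 - x * (4 * (B + 1))) by rewrite mulr_ge0 ?subr_ge0 // ltW.
  have : 0 <= E * x by rewrite mulr_ge0 // ltW.
  nra.
have c0t : cabs (term 0%N t) = E * c0 by rewrite cterm expr0 mulr1.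
have : cabs (term 0%N t) <= cabs (term 0%N t + S) + cabs S.
  by rewrite -[X in cabs X <= _](addrK S) cabsB.
rewrite c0t; lra.
Qed.

End QSeries.

(** * The Eisenstein series E_2 *)

Section Eisenstein.
Context {R : realType}.
Local Notation C := (Cplx R).
Implicit Types (x y : R) (z w t : C) (a b d n m p r : nat).

Definition sigma_qterm t n : C := (sigma n.+1)%:R * qpow 1 t ^+ n.+1.

(** Here [|q| = exp (- 4 c)]. Half of the decay absorbs [sigma M <= 2 M^2], through
    [M exp (- c M) <= 1 / c]; the other half leaves a geometric series of ratio [exp (- 2 c)]. *)
Lemma sigma_qseries_cvg t : upper t -> cvgn (series (sigma_qterm t)).
Proof.
move=> ut; pose c := pi * Im t / 2.
have c0 : 0 < c by rewrite divr_gt0 // mulr_gt0 ?pi_gt0.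
pose z := expR (- (2 * c)).
have z1 : `|z| < 1.
  by rewrite ger0_norm ?expR_ge0 // expR_lt1 oppr_lt0 mulr_gt0.
apply: (cvgn_series_bound _ (is_cvg_geometric_series (a := 2 / c ^+ 2 * z) z1)) => n.
rewrite /sigma_qterm cabsM cabsX cabs_qpow -RtoC_nat cabs_RtoC ger0_norm //.
set M := n.+1; have -> : expR (- (2 * pi * 1 * Im t)) = z * expR (- c) ^+ 2.
  by rewrite /z -expRM_natl -expRD; congr expR; rewrite /c; field.
have zM : 0 <= z ^+ M by rewrite exprn_ge0 ?expR_ge0.
rewrite /geometric /= -[_ * z * _]mulrA -exprS -/M exprMn mulrCA mulrC ler_wpM2r //.
have small : M%:R * expR (- c) ^+ M <= c^-1.
  rewrite -expRM_natl mulrN expRN ler_pdivrMr ?expR_gt0 // mulrC ler_pdivlMr //.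
  by apply: le_trans (expR_ge1Dx _); lra.
have sM : (sigma M)%:R <= 2 * M%:R ^+ 2 :> R.
  have := sigma_leq (ltn0Sn n); rewrite -(ler_nat R) -/M => h; apply: le_trans h _.
  rewrite -[M.+1]addn1 natrM natrD; have : (1 : R) <= M%:R by rewrite ler1n.
  nra.
rewrite -exprM mulnC exprM.
have e0 : 0 <= (expR (- c) ^+ M) ^+ 2 by rewrite sqr_ge0.
apply: le_trans (ler_wpM2r e0 sM) _; rewrite -mulrA -exprMn ler_wpM2l // -exprVn.
apply: lerXn2r => //; rewrite nnegrE; last by rewrite invr_ge0 ltW.
by rewrite mulr_ge0 // exprn_ge0 ?expR_ge0.
Qed.

Lemma sum_dvdn (V : zmodType) (F : nat -> V) d K : (0 < d)%N ->
  \sum_(0 <= m < d * K | (d %| m.+1)%N) F m.+1 = \sum_(0 <= m < K) F (d * m.+1)%N.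
Proof.
case: d => // d _; elim: K => [|K IH]; first by rewrite muln0 !big_geq.
rewrite big_nat_recr //= -IH mulnS addnC.
rewrite (@big_cat_nat _ _ _ (d.+1 * K)) ?leq_addr //=; congr (_ + _).
rewrite addnS big_mkcond big_nat_recr ?leq_addr //= big_nat big1 => [|m /andP[m1 m2]].
  rewrite add0r ifT; first by congr F; lia.
  by rewrite -addnS dvdn_add ?dvdn_mulr.
rewrite ifN //; have -> : m.+1 = (d.+1 * K + (m.+1 - d.+1 * K))%N by lia.
rewrite dvdn_addr ?dvdn_mulr //; apply/negP => /dvdn_leq; lia.
Qed.

Definition unity d : C := cexp (twopii / d%:R).

Lemma unityX d : (0 < d)%N -> unity d ^+ d = 1.
Proof.
move=> d0; rewrite /unity -cexpM_natl mulrC divfK ?cexp_twopii //.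
by rewrite pnatr_eq0 -lt0n.
Qed.

(** With [th = pi j / d] strictly between 0 and [pi], the value 1 would mean [cos (2 th) = 1], hence
    [sin th = 0]. *)
Lemma unity_neq1 d j : (0 < j < d)%N -> unity d ^+ j != 1.
Proof.
move=> /andP[j0 jd]; have d0 : (0 < d)%N by exact: ltn_trans jd.
apply/eqP => /(congr1 (fun z : C => Re z)).
have dR : 0 < d%:R :> R by rewrite ltr0n.
pose th : R := pi * (j%:R / d%:R).
have -> : unity d ^+ j = cexp ((0 +i* (th *+ 2))%C : C).
  rewrite /unity -cexpM_natl; congr cexp; rewrite -!RtoC_nat -RtoCV.
  by apply: C_ext; rewrite !ReImE /= /th -mulr_natr; field; rewrite gt_eqF.
rewrite /cexp /= expR0 mul1r cos_mulr2n => h.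
have : 0 < sin th.
  apply: sin_gt0_pi; rewrite /th mulr_gt0 ?pi_gt0 ?divr_gt0 ?ltr0n //=.
  by rewrite gtr_pMr ?pi_gt0 // ltr_pdivrMr // mul1r ltr_nat.
have := cos2Dsin2 th; move: h; rewrite -mulr_natr; nra.
Qed.

Lemma sum_unity d M : (0 < d)%N ->
  \sum_(b < d) (unity d ^+ M) ^+ b = if (d %| M)%N then d%:R else 0.
Proof.
move=> d0; case: ifP => dM.
  have -> : unity d ^+ M = 1.
    by have /dvdnP[k ->] := dM; rewrite mulnC exprM unityX // expr1n.
  by under eq_bigr do rewrite expr1n; rewrite sumr_const card_ord.
have n1 : unity d ^+ M != 1.
  rewrite (divn_eq M d) exprD mulnC exprM unityX // expr1n mul1r.
  by apply: unity_neq1; rewrite ltn_mod d0 lt0n -/(dvdn d M) dM.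
apply: (mulfI (_ : unity d ^+ M - 1 != 0)); first by rewrite subr_eq0.
by rewrite -subrX1 mulr0 -exprM mulnC exprM unityX // expr1n subrr.
Qed.

(** At [(a t + b) / d] the variable [q] becomes [U * unity d ^+ b] with [U^d = q^a]. Summing over
    [b] leaves the exponents divisible by [d], and the cutoff [d * K] leaves exactly
    [d, 2 d, ..., K d]. *)
Lemma sigma_qseries_average t a d K : (0 < d)%N ->
  \sum_(b < d) series (sigma_qterm ((a%:R * t + b%:R) / d%:R)) (d * K)%N
  = d%:R * \sum_(0 <= m < K) (sigma (d * m.+1))%:R * qpow 1 t ^+ (a * m.+1).
Proof.
move=> d0; have dC : d%:R != 0 :> C by rewrite pnatr_eq0 -lt0n.
pose U : C := cexp (twopii * (a%:R * t / d%:R)).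
have UX : U ^+ d = qpow 1 t ^+ a.
  rewrite /U -cexpM_natl /qpow -cexpM_natl (RtoC_nat 1); congr cexp; field; exact: dC.
have qE b : qpow 1 ((a%:R * t + b%:R) / d%:R) = U * unity d ^+ b.
  rewrite /U /unity /qpow -cexpM_natl -cexpD (RtoC_nat 1); congr cexp.
  by field; exact: dC.
rewrite /series /=; under eq_bigr do under eq_bigr do rewrite /sigma_qterm qE.
rewrite exchange_big /=.
transitivity (\sum_(0 <= m < d * K | (d %| m.+1)%N)
   (fun M => d%:R * ((sigma M)%:R * U ^+ M)) m.+1).
  rewrite [RHS]big_mkcond; apply: eq_bigr => m _ /=.
  transitivity ((sigma m.+1)%:R * U ^+ m.+1 * \sum_(b < d) (unity d ^+ m.+1) ^+ b).
    rewrite big_distrr /=; apply: eq_bigr => b _.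
    by rewrite exprMn -!mulrA -!exprM [(b * _)%N]mulnC.
  by rewrite sum_unity //; case: ifP => _; rewrite ?mulr0 // mulrC.
rewrite (sum_dvdn (fun M => d%:R * ((sigma M)%:R * U ^+ M))) // big_distrr /=.
by apply: eq_bigr => m _; rewrite !exprM UX -exprM.
Qed.

(** With [n = p ^ r], of the [d * (d * J)] terms [d * J] survive the average over [b], and the
    exponents of [q] are then the multiples of [n / d] up to [n * J], a cutoff common to all [d]. *)
Lemma sigma_qseries_hecke t p r J : prime p ->
  \sum_(d <- divisors (p ^ r)) (p ^ r)%:R / d%:R ^+ 2
    * \sum_(b < d) series (sigma_qterm (((p ^ r %/ d)%:R * t + b%:R) / d%:R)) (d * (d * J))%N
  = (sigma (p ^ r))%:R * series (sigma_qterm t) (p ^ r * J)%N.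
Proof.
move=> pp; set n := (p ^ r)%N.
have n0 : (0 < n)%N by rewrite expn_gt0 prime_gt0.
transitivity (\sum_(d <- divisors n) \sum_(0 <= m < n * J)
  if (n %/ d %| m.+1)%N
  then (n %/ d * sigma (d * (m.+1 %/ (n %/ d))))%N%:R * qpow 1 t ^+ m.+1 else 0).
  rewrite big_seq [RHS]big_seq; apply: eq_bigr => d.
  rewrite -dvdn_divisors // => dn; have d0 := dvdn_gt0 n0 dn.
  have dle := dvdn_leq n0 dn; have a0 : (0 < n %/ d)%N by rewrite divn_gt0.
  have nE : n = (n %/ d * d)%N by rewrite divnK.
  rewrite sigma_qseries_average // -big_mkcond /=.
  have nJ : (n * J = n %/ d * (d * J))%N by rewrite mulnA -nE.
  rewrite nJ (sum_dvdn (fun M =>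
     (n %/ d * sigma (d * (M %/ (n %/ d))))%N%:R * qpow 1 t ^+ M)) //.
  rewrite mulrA big_distrr /=; apply: eq_bigr => m _.
  rewrite mulKn // mulrA natrM; congr (_ * _ * _).
  have nC : n%:R = (n %/ d)%:R * d%:R :> C by rewrite -natrM -nE.
  by rewrite nC; field; rewrite pnatr_eq0 -lt0n.
rewrite exchange_big /= /series /= big_distrr /=; apply: eq_bigr => m _.
rewrite -big_mkcond /= -big_distrl /= -natr_sum sigma_hecke // natrM -mulrA.
by [].
Qed.

Lemma cvgC_sum (I : eqType) (s : seq I) (u : I -> nat -> C) (l : I -> C) :
  (forall i, i \in s -> u i @ \oo --> l i) ->
  (fun J => \sum_(i <- s) u i J) @ \oo --> \sum_(i <- s) l i.
Proof.
elim: s => [|i s IH] h.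
  rewrite big_nil (_ : (fun _ => _) = fun=> 0); first exact: cvg_cst.
  by apply/funext => J; rewrite big_nil.
rewrite big_cons (_ : (fun _ => _) = fun J => u i J + \sum_(i <- s) u i J); last first.
  by apply/funext => J; rewrite big_cons.
apply: cvgD; first by apply: h; rewrite inE eqxx.
by apply: IH => j js; apply: h; rewrite inE js orbT.
Qed.

Lemma cvgC_subseq (u : nat -> C) (l : C) (g : nat -> nat) : (forall J, (J <= g J)%N) ->
  u @ \oo --> l -> (fun J => u (g J)) @ \oo --> l.
Proof.
move=> hg /cvgnCP h; apply/cvgnCP => e /h[N hN]; exists N => J NJ.
by apply: hN; apply: leq_trans (hg J).
Qed.

Lemma sum_codivisors n : (0 < n)%N -> (\sum_(d <- divisors n) n %/ d)%N = sigma n.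
Proof.
move=> n0; have divK d : (d %| n)%N -> (n %/ (n %/ d))%N = d.
  move=> dn; have d0 := dvdn_gt0 n0 dn; have dle := dvdn_leq n0 dn.
  have q0 : (0 < n %/ d)%N by rewrite divn_gt0.
  have e := divnK dn; by rewrite -[X in (X %/ _)%N]e mulKn.
rewrite /sigma -(big_map (fun d => n %/ d)%N xpredT id) /=.
apply: perm_big; apply: uniq_perm; rewrite ?divisors_uniq //.
  rewrite map_inj_in_uniq ?divisors_uniq // => a b.
  by rewrite -!dvdn_divisors // => an bn e; rewrite -(divK a) // e divK.
move=> d; rewrite -dvdn_divisors //; apply/mapP/idP => [[e + ->]|dn].
  by rewrite -dvdn_divisors // => en; rewrite dvdn_div.
by exists (n %/ d)%N; rewrite ?divK // -dvdn_divisors // dvdn_div.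
Qed.

Lemma upper_hecke t a b d : (0 < a)%N -> (0 < d)%N -> upper t ->
  upper ((a%:R * t + b%:R) / d%:R).
Proof.
move=> a0 d0; rewrite /upper -!RtoC_nat -RtoCV !ReImE /= => ut.
have h : 0 < a%:R * Im t / d%:R by rewrite divr_gt0 ?mulr_gt0 ?ltr0n.
by apply: lt_le_trans h _; rewrite le_eqVlt; apply/orP; left; apply/eqP; ring.
Qed.

(** The [d] constant terms belonging to [d] add up to [n / d], and these sum to [sigma n]. The rest
    is the limit of [sigma_qseries_hecke] as [J] grows. *)
Lemma E2_hecke t p r : prime p -> upper t ->
  \sum_(d <- divisors (p ^ r)) \sum_(b < d)
    (p ^ r)%:R / d%:R ^+ 2 * E2 (((p ^ r %/ d)%:R * t + b%:R) / d%:R)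
  = (sigma (p ^ r))%:R * E2 t.
Proof.
move=> pp ut; set n := (p ^ r)%N.
have n0 : (0 < n)%N by rewrite expn_gt0 prime_gt0.
pose L w : C := limn (series (sigma_qterm w)).
have cL w : upper w -> series (sigma_qterm w) @ \oo --> L w.
  exact: sigma_qseries_cvg.
pose tw d b : C := ((n %/ d)%:R * t + b%:R) / d%:R.
have ltw d b : d \in divisors n -> upper (tw d b).
  rewrite -dvdn_divisors // => dn; have d0 := dvdn_gt0 n0 dn.
  have dle := dvdn_leq n0 dn.
  by apply: upper_hecke => //; rewrite divn_gt0.
have key : \sum_(d <- divisors n) n%:R / d%:R ^+ 2 * \sum_(b < d) L (tw d b)
    = (sigma n)%:R * L t.
  pose lf J : C := \sum_(d <- divisors n) n%:R / d%:R ^+ 2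
      * \sum_(b < d) series (sigma_qterm (tw d b)) (d * (d * J))%N.
  pose rf J : C := (sigma n)%:R * series (sigma_qterm t) (n * J)%N.
  have lhs : lf @ \oo --> \sum_(d <- divisors n) n%:R / d%:R ^+ 2 * \sum_(b < d) L (tw d b).
    apply: (cvgC_sum (u := fun d J => n%:R / d%:R ^+ 2
      * \sum_(b < d) series (sigma_qterm (tw d b)) (d * (d * J))%N)) => d dn.
    apply: cvgM; first exact: cvg_cst.
    apply: (cvgC_sum (u := fun (b : 'I_d) J => series (sigma_qterm (tw d b)) (d * (d * J))%N)).
    move=> b _; apply: (cvgC_subseq (g := fun J => (d * (d * J))%N)); last exact/cL/ltw.
    move: dn; rewrite -dvdn_divisors // => /(dvdn_gt0 n0) d0 J.
    by rewrite mulnA leq_pmull // muln_gt0 d0.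
  have rhs : rf @ \oo --> (sigma n)%:R * L t.
    apply: cvgM; first exact: cvg_cst.
    apply: (cvgC_subseq (g := fun J => (n * J)%N)); last exact: cL.
    by move=> J; rewrite leq_pmull.
  have lr : lf = rf by apply/funext => J; exact: sigma_qseries_hecke.
  by rewrite lr in lhs; exact: (cvg_unique _ lhs rhs).
have E2E w : E2 w = 1 - 24%:R * L w by [].
under eq_bigr do rewrite -big_distrr /=.
rewrite E2E mulrBr mulr1 mulrCA -key big_distrr /= -sum_codivisors // natr_sum -sumrB.
rewrite big_seq [RHS]big_seq; apply: eq_bigr => d; rewrite -dvdn_divisors // => dn.
have d0 := dvdn_gt0 n0 dn; have dC : d%:R != 0 :> C by rewrite pnatr_eq0 -lt0n.
under eq_bigr do rewrite E2E.
rewrite sumrB -big_distrr /= sumr_const card_ord mulrBr; congr (_ - _); last first.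
  by rewrite mulrCA.
have nC : n%:R = (n %/ d)%:R * d%:R :> C by rewrite -natrM divnK.
by rewrite nC; field.
Qed.

End Eisenstein.

(** * Logarithmic derivatives and the Hecke operators *)

Section LogDerivative.
Context {R : realType}.
Local Notation C := (Cplx R).
Implicit Types (F G f : C -> C) (z w t c l m : C).

(** Nonvanishing is part of the notion, so that it is closed under products; the derivative is
    stated as [F t * l] to avoid division. *)
Definition has_logderiv F t l := F t != 0 /\ is_derive t 1 F (F t * l).

Lemma has_logderiv_cst c t : c != 0 -> has_logderiv (fun=> c) t 0.
Proof. by move=> c0; split => //; rewrite mulr0; exact: is_derive_cst. Qed.

Lemma has_logderivM F G t l m : has_logderiv F t l -> has_logderiv G t m ->
  has_logderiv (fun z => F z * G z) t (l + m).
Proof.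
move=> [F0 dF] [G0 dG]; split; first by rewrite mulf_neq0.
have := is_deriveM dF dG; rewrite -[F * G]/(fun z => F z * G z).
move=> h; apply: is_derive_eq h _; rewrite -![_ *: _]/(_ * _); ring.
Qed.

Lemma has_logderiv_prod (I : eqType) (s : seq I) (F : I -> C -> C) (l : I -> C) t :
  (forall i, i \in s -> has_logderiv (F i) t (l i)) ->
  has_logderiv (fun z => \prod_(i <- s) F i z) t (\sum_(i <- s) l i).
Proof.
elim: s => [|i s IH] h.
  rewrite big_nil (_ : (fun _ => _) = fun=> 1).
    exact: has_logderiv_cst (oner_neq0 _).
  by apply/funext => z; rewrite big_nil.
rewrite big_cons (_ : (fun _ => _) = fun z => F i z * \prod_(i <- s) F i z); last first.
  by apply/funext => z; rewrite big_cons.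
apply: has_logderivM; first by apply: h; rewrite inE eqxx.
by apply: IH => j js; apply: h; rewrite inE js orbT.
Qed.

Lemma is_derive_affine f c z t l : is_derive (c * t + z) 1 f l ->
  is_derive t 1 (fun w => f (c * w + z)) (c * l).
Proof.
move=> /is_deriveCP h; apply/is_deriveCP => e e0.
have c1 : 0 < cabs c + 1 by rewrite ltr_wpDl ?cabs_ge0.
have [d d0 hd] := h _ (divr_gt0 e0 c1).
exists (d / (cabs c + 1)) => [|w]; first by rewrite divr_gt0.
rewrite ltr_pdivlMr // => hw.
have e1 : c * w + z - (c * t + z) = c * (w - t) by ring.
have := hd (c * w + z); rewrite e1 cabsM => hh.
have cw := cabs_ge0 (w - t); have cc := cabs_ge0 c.
have {}hh := hh ltac:(nra).
rewrite [c * l]mulrC -[l * c * _]mulrA; apply: le_trans hh _.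
rewrite mulrA ler_wpM2r // mulrAC ler_pdivrMr // ler_wpM2l ?ltW //.
by rewrite ltrDl.
Qed.

Lemma has_logderiv_affine f c z t : f (c * t + z) != 0 ->
  derivable f (c * t + z) 1 ->
  has_logderiv (fun w => f (c * w + z)) t (c * (f^`()%classic (c * t + z) / f (c * t + z))).
Proof.
move=> f0 df; split; [exact: f0|rewrite derive1E].
rewrite mulrCA [f _ * _]mulrC divfK; [|exact: f0].
exact: is_derive_affine (derivableP df).
Qed.

Lemma Theta_logderiv F t l : has_logderiv F t l -> Theta F t / F t = twopii^-1 * l.
Proof.
by move=> [F0 [_ dF]]; rewrite /Theta derive1E dF -mulrA mulrAC mulfV ?mul1r.
Qed.

Lemma near_seq (I : eqType) (s : seq I) (T : Type) (A : set_system T) (FA : Filter A)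
    (P : I -> T -> Prop) :
  (forall i, i \in s -> \forall t \near A, P i t) ->
  \forall t \near A, forall i, i \in s -> P i t.
Proof.
elim: s => [|i s IH] h; first by near=> t.
have h1 : \forall t \near A, P i t by apply: h; rewrite inE eqxx.
have h2 : \forall t \near A, forall i, i \in s -> P i t.
  by apply: IH => j js; apply: h; rewrite inE js orbT.
near=> t; move=> j; rewrite inE => /predU1P[->|]; last by apply: (near h2 t).
exact: (near h1 t).
Unshelve. all: by end_near. Qed.

Lemma near_dnbhs_affine (P : C -> Prop) c z t0 : c != 0 ->
  (\forall w \near (c * t0 + z)^', P w) -> \forall t \near t0^', P (c * t + z).
Proof.
move=> c0 /dnbhsCP[e e0 h]; have cc : 0 < cabs c by rewrite cabs_gt0.
apply/dnbhsCP; exists (e / cabs c) => [|w]; first by rewrite divr_gt0.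
rewrite ltr_pdivlMr // => hw wt; have e1 : c * w + z - (c * t0 + z) = c * (w - t0) by ring.
apply: h; first by rewrite e1 cabsM mulrC.
by rewrite -subr_eq0 e1 mulf_neq0 ?subr_eq0.
Qed.

End LogDerivative.

(** * Slash factors, the normalising constant, regularity of [f] *)

Section Hecke.
Context {R : realType}.
Local Notation C := (Cplx R).
Implicit Types (f : C -> C) (t : C) (a b d n p r : nat) (k : int).

Definition slash_coef k a d : C :=
  RtoC ((a * d)%:R `^ (k%:~R / 2)) * (d%:R : C) ^ (- k).

Lemma det_upper_triangular (a b d : int) : \det (mx2 a b 0 d) = a * d.
Proof.
by rewrite (expand_det_row _ 0) !big_ord_recl big_ord0 /cofactor !det_mx11 !mxE /=; ring.
Qed.

Lemma slash_upper_triangular k a b d f t :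
  slash k (mx2 a%:Z b%:Z 0 d%:Z) f t = slash_coef k a d * f ((a%:R * t + b%:R) / d%:R).
Proof.
rewrite /slash /moebius /automorphy det_upper_triangular !mxE /= mulr0z mul0r add0r.
by rewrite -PoszM.
Qed.

Lemma slash_coef_neq0 k a d : (0 < a)%N -> (0 < d)%N -> slash_coef k a d != 0.
Proof.
move=> a0 d0; rewrite /slash_coef mulf_neq0 //.
  rewrite -cabs_eq0 cabs_RtoC normr_eq0 gt_eqF // powR_gt0 // ltr0n muln_gt0 a0 //.
by rewrite expfz_neq0 // pnatr_eq0 -lt0n.
Qed.

Lemma slash_coef2 a d : slash_coef 2 a d = (a * d)%:R / d%:R ^+ 2.
Proof.
rewrite /slash_coef (_ : 2%:~R / 2 = 1 :> R); last by rewrite divff ?pnatr_eq0.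
by rewrite powRr1 ?ler0n // RtoC_nat.
Qed.

(** Either the default value 1 is taken, or the normalised function has leading coefficient 1 and so
    is nonzero high up, which a zero constant would forbid. *)
Lemma hecke_eps_neq0 k p r f : hecke_eps k p r f != 0.
Proof.
rewrite /hecke_eps; case: xgetP => [e _ he|_]; last exact: oner_neq0.
apply/eqP => e0; move: he; rewrite /= e0 => -[kappa [a [a0 /(fourier_expansion_neq0 a0)[Y hY]]]].
have := ler_norm Y; pose t : C := (0 +i* (`|Y| + 1))%C => hn.
have /dnbhs_nonempty[w] : \forall w \near t^', 0 * hecke_mul_raw k p r f w != 0.
  by apply: hY; rewrite /upper /=; [rewrite ltr_wpDl|lra].
by rewrite mul0r eqxx.
Qed.

Lemma in_calM_regular N k f t0 : in_calM N k f -> upper t0 ->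
  \forall t \near t0^', f t != 0 /\ derivable f t 1.
Proof.
move=> [mf _ _ [kappa [a [a0 hF]]]] ut0.
have a0C : (fun n => (a n)%:~R : C) 0%N = 1 by rewrite a0.
have [Y hY] := fourier_expansion_neq0 a0C hF.
pose t1 : C := (0 +i* (`|Y| + 1))%C.
have u1 : upper t1 by rewrite /upper /= ltr_wpDl.
have h1 : \forall t \near t1^', f t != 0.
  by apply: hY => //=; have := ler_norm Y; lra.
have := meromorphic_nonzero mf u1 h1 ut0.
have := meromorphic_at_derivable (mf _ ut0).
by move=> h2 h3; near=> t; split; near: t.
Unshelve. all: by end_near. Qed.

End Hecke.

(* f|T(p^r) has weight k * sigma(p^r). *)
Theorem theorem5p2 (R : realType) (N p r : nat) (k : int)
    (f : Cplx R -> Cplx R)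
    (hN : (0 < N)%N) (hp : prime p) (hpN : coprime p N) (hr : (0 < r)%N)
    (hf : in_calM N k f) :
  mero_eq (frakD (k * (sigma (p ^ r))%:Z) (hecke_mul k p r f))
          (hecke_T2 (p ^ r) (frakD k f)).
Proof.
move=> t0 ut0; set n := (p ^ r)%N.
have n0 : (0 < n)%N by rewrite expn_gt0 prime_gt0.
pose tw d b (t : Cplx R) : Cplx R := ((n %/ d)%:R * t + b%:R) / d%:R.
have dvd d : d \in divisors n -> [/\ (0 < d)%N, (0 < n %/ d)%N & n = (n %/ d * d)%N].
  rewrite -dvdn_divisors // => dn; have d0 := dvdn_gt0 n0 dn.
  by have dle := dvdn_leq n0 dn; split; rewrite ?divnK ?divn_gt0.
have twE d b t : tw d b t = (n %/ d)%:R / d%:R * t + b%:R / d%:R.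
  by rewrite /tw mulrDl mulrAC.
(* For each of the finitely many pairs [d], [b], the regularity of [f] around [tw d b t0] is pulled
   back along an affine map. *)
have reg : \forall t \near t0^', forall d, d \in divisors n -> forall b, b \in iota 0 d ->
    f (tw d b t) != 0 /\ derivable f (tw d b t) 1.
  apply: near_seq => d dn; apply: near_seq => b _; have [d0 a0 _] := dvd d dn.
  have c0 : (n %/ d)%:R / d%:R != 0 :> Cplx R.
    by rewrite mulf_neq0 ?invr_eq0 // pnatr_eq0 -lt0n.
  have uw : upper (tw d b t0) by exact: upper_hecke.
  have := in_calM_regular hf uw; rewrite twE => h.
  have := near_dnbhs_affine c0 h; apply: filterS => t; by rewrite twE.
have ut : \forall t \near t0^', upper t.
  apply/dnbhsCP; exists (Im t0) => // t ht _; rewrite /upper.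
  have := Im_le_cabs (t - t0); rewrite !ReImE ler_norml => /andP[h _]; lra.
near=> t; have regt : forall d, d \in divisors n -> forall b, b \in iota 0 d ->
    f (tw d b t) != 0 /\ derivable f (tw d b t) 1 by near: t.
have utt : upper t by near: t.
(* The chain rule factor [(n / d) / d] equals [n / d^2], the factor of the weight 2 slash
   operator. *)
pose ld d (b : nat) : Cplx R :=
  (n %/ d)%:R / d%:R * (f^`()%classic (tw d b t) / f (tw d b t)).
have LD : has_logderiv (hecke_mul k p r f) t (\sum_(d <- divisors n) \sum_(b < d) ld d b).
  (* The zeros inserted here and below are the logarithmic derivatives of the constants [hecke_eps],
     [hecke_factor] and [slash_coef]. *)
  rewrite -[\sum_(d <- divisors n) _]add0r; apply: has_logderivM.
    exact/has_logderiv_cst/hecke_eps_neq0.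
  rewrite -[\sum_(d <- divisors n) _]add0r; apply: has_logderivM.
    apply: has_logderiv_cst; rewrite -cabs_eq0 cabs_RtoC normr_eq0 gt_eqF // powR_gt0 //.
    by rewrite ltr0n prime_gt0.
  apply: has_logderiv_prod => d dn; apply: has_logderiv_prod => b _.
  have [d0 a0 _] := dvd d dn.
  rewrite (_ : slash _ _ _ = fun w => slash_coef k (n %/ d) d
      * f ((n %/ d)%:R / d%:R * w + (b : nat)%:R / d%:R)); last first.
    by apply/funext => w; rewrite slash_upper_triangular -twE.
  rewrite -[ld d b]add0r; apply: has_logderivM.
    exact/has_logderiv_cst/slash_coef_neq0.
  have bd : (b : nat) \in iota 0 d by rewrite mem_iota add0n ltn_ord.
  have [f0 df] := regt d dn b bd; rewrite /ld twE; rewrite twE in f0 df.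
  exact: has_logderiv_affine.
rewrite {1}/frakD (Theta_logderiv LD) /hecke_T2 intrM -[(sigma n)%:Z%:~R]/((sigma n)%:R).
(* The eigenvalue equation, read from right to left, expands the single [E2] term into a double sum,
   and the two sides are then compared term by term. *)
rewrite -[k%:~R * _ * _]mulrA -(E2_hecke r hp utt) -/n.
rewrite !big_distrr /= big_distrl /= -sumrB big_seq [RHS]big_seq.
apply: eq_bigr => d dn; have [d0 a0 nE] := dvd d dn.
have dC : d%:R != 0 :> Cplx R by rewrite pnatr_eq0 -lt0n.
rewrite !big_distrr /= big_distrl /= -sumrB; apply: eq_bigr => b _.
rewrite slash_upper_triangular slash_coef2 /frakD /Theta /ld -/(tw d b t) -nE.
have nC : n%:R = (n %/ d)%:R * d%:R :> Cplx R by rewrite -natrM -nE.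
rewrite nC; move: (f^`()%classic _) (f _)^-1 (E2 _) twopii^-1 => A B X Y.
by field; rewrite dC.
Unshelve. all: by end_near. Qed.
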